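(* Let $0<m<\infty$, let $\zeta\in\mathbb{C}^m$, and let $E$ be an infinite dimensional complex Banach space. Then the $\mathcal{O}_\zeta$-module $\mathcal{O}^E_\zeta$ is not free; moreover, it cannot be embedded in a free module, i.e., there is no injective $\mathcal{O}_\zeta$-homomorphism from $\mathcal{O}^E_\zeta$ into a free $\mathcal{O}_\zeta$-module.
   Context: $\mathcal{O}^E_\zeta$ denotes the set of germs at $\zeta\in\mathbb{C}^m$ of holomorphic functions with values in the Banach space $E$; $\mathcal{O}_\zeta=\mathcal{O}^{\mathbb{C}}_\zeta$ is the local ring of scalar holomorphic germs at $\zeta$, and $\mathcal{O}^E_\zeta$ is an $\mathcal{O}_\zeta$-module by pointwise multiplication. Free modules may have arbitrary (infinite) rank. *)

(* Defs.v *)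
From HB Require Import structures.
From mathcomp Require Import all_boot all_order all_algebra generic_quotient.
From mathcomp Require Import finmap.
From mathcomp Require Import all_classical all_reals all_analysis.

Set Implicit Arguments.
Unset Strict Implicit.
Unset Printing Implicit Defensive.

Import Order.TTheory GRing.Theory Num.Theory.
Import numFieldNormedType.Exports.

Local Open Scope classical_set_scope.
Local Open Scope ring_scope.
Local Open Scope quotient_scope.

Section Germs.
(* The construction makes sense over any [K : numFieldType], but it gives germs
   of holomorphic maps only when [K] is the field [R[i]] of complex numbers:
   [differentiable] is then Fréchet differentiability with a continuous
   complex linear differential. *)
Variables (K : numFieldType) (m : nat) (zeta : 'rV[K]_m).

(* [f] is holomorphic on some neighbourhood of [zeta]; its values elsewhere
   are irrelevant. *)
Definition holomorphic_at (V : normedModType K) (f : 'rV[K]_m -> V) : Prop :=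
  \forall z \near zeta, differentiable f z.

Lemma holomorphic_at_cst (V : normedModType K) (v : V) :
  holomorphic_at (cst v).
Proof. by rewrite /holomorphic_at; near=> z; exact: differentiable_cst.
Unshelve. all: by end_near. Qed.

Lemma holomorphic_atD (V : normedModType K) (f g : 'rV[K]_m -> V) :
  holomorphic_at f -> holomorphic_at g -> holomorphic_at (f + g).
Proof.
by rewrite /holomorphic_at; apply: filterS2 => z; exact: differentiableD.
Qed.

Lemma holomorphic_atN (V : normedModType K) (f : 'rV[K]_m -> V) :
  holomorphic_at f -> holomorphic_at (- f).
Proof.
by rewrite /holomorphic_at; apply: filterS => z; exact: differentiableN.
Qed.

Lemma scaler_is_bilinear (V : normedModType K) :
  bilinear_for
    (GRing.Scale.Law.clone _ _ *:%R _) (GRing.Scale.Law.clone _ _ *:%R _)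
    (fun (k : K^o) (v : V) => k *: v).
Proof.
split=> [v|k] a x y /=.
- by rewrite scalerDl scalerA.
- by rewrite scalerDr !scalerA mulrC.
Qed.

Lemma differentiable_scaler (V : normedModType K)
    (k : 'rV[K]_m -> K^o) (f : 'rV[K]_m -> V) (z : 'rV[K]_m) :
  differentiable k z -> differentiable f z ->
  differentiable (fun x => k x *: f x) z.
Proof.
move=> dk df.
pose sM := bilinear_isBilinear.Build K K^o V V _ _ _ (@scaler_is_bilinear V).
pose s : {bilinear K^o -> V -> V} :=
  HB.pack (fun (k : K^o) (v : V) => k *: v) sM.
have ds : differentiable (fun p : K^o * V => s p.1 p.2) (k z, f z).
  by apply: differentiable_bilin => p; exact: scale_continuous.
exact: differentiable_comp (differentiable_pair dk df) ds.
Qed.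

Lemma holomorphic_atZ (V : normedModType K)
    (k : 'rV[K]_m -> K^o) (f : 'rV[K]_m -> V) :
  holomorphic_at k -> holomorphic_at f ->
  holomorphic_at (fun x => k x *: f x).
Proof.
by rewrite /holomorphic_at; apply: filterS2 => z; exact: differentiable_scaler.
Qed.

Record holo (V : normedModType K) := Holo {
  holo_fun :> 'rV[K]_m -> V;
  holo_holomorphic : holomorphic_at holo_fun }.

HB.instance Definition _ (V : normedModType K) := gen_eqMixin (holo V).
HB.instance Definition _ (V : normedModType K) := gen_choiceMixin (holo V).

Definition germ_eq (V : normedModType K) (f g : holo V) : bool :=
  `[< \forall z \near zeta, f z = g z >].

Lemma germ_eq_refl (V : normedModType K) : reflexive (@germ_eq V).
Proof. by move=> f; apply/asboolP; near=> z.
Unshelve. all: by end_near. Qed.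

Lemma germ_eq_sym (V : normedModType K) : symmetric (@germ_eq V).
Proof.
by move=> f g; apply/asboolP/asboolP; apply: filterS => z ->.
Qed.

Lemma germ_eq_trans (V : normedModType K) : transitive (@germ_eq V).
Proof.
move=> g f h /asboolP fg /asboolP gh; apply/asboolP.
by move: fg gh; apply: filterS2 => z -> ->.
Qed.

Canonical germ_equiv (V : normedModType K) :=
  EquivRel (@germ_eq V) (@germ_eq_refl V) (@germ_eq_sym V) (@germ_eq_trans V).

Definition germ (V : normedModType K) : Type := {eq_quot (@germ_equiv V)}.

HB.instance Definition _ (V : normedModType K) := Choice.on (germ V).
HB.instance Definition _ (V : normedModType K) := EqQuotient.on (germ V).

Lemma germP (V : normedModType K) (f g : holo V) :
  reflect (\forall z \near zeta, f z = g z) (\pi_(germ V) f == \pi_(germ V) g).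
Proof. by rewrite piE; exact: asboolP. Qed.

Lemma germ_repr (V : normedModType K) (f : holo V) :
  \forall z \near zeta, repr (\pi_(germ V) f) z = f z.
Proof. by apply/germP; rewrite reprK. Qed.

Section Module.
Variable V : normedModType K.

Definition germ0 : germ V := \pi_(germ V) (Holo (holomorphic_at_cst (0 : V))).
Definition germ_opp (f : germ V) : germ V :=
  \pi_(germ V) (Holo (holomorphic_atN (holo_holomorphic (repr f)))).
Definition germ_add (f g : germ V) : germ V :=
  \pi_(germ V) (Holo (holomorphic_atD (holo_holomorphic (repr f))
                             (holo_holomorphic (repr g)))).
Definition germ_scale (k : germ K^o) (f : germ V) : germ V :=
  \pi_(germ V) (Holo (holomorphic_atZ (holo_holomorphic (repr k))
                             (holo_holomorphic (repr f)))).

Lemma germ_eqP (f g : germ V) :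
  (\forall z \near zeta, repr f z = repr g z) -> f = g.
Proof. by move=> fg; rewrite -[f]reprK -[g]reprK; apply/eqP/germP. Qed.

Lemma germ0E : \forall z \near zeta, repr germ0 z = 0.
Proof. exact: germ_repr. Qed.

Lemma germ_oppE (f : germ V) :
  \forall z \near zeta, repr (germ_opp f) z = - repr f z.
Proof. exact: germ_repr. Qed.

Lemma germ_addE (f g : germ V) :
  \forall z \near zeta, repr (germ_add f g) z = repr f z + repr g z.
Proof. exact: germ_repr. Qed.

Lemma germ_scaleE (k : germ K^o) (f : germ V) :
  \forall z \near zeta, repr (germ_scale k f) z = repr k z *: repr f z.
Proof. exact: germ_repr. Qed.

Lemma germ_addA : associative germ_add.
Proof.
move=> f g h; apply: germ_eqP.
apply: filterS3 (germ_addE f (germ_add g h)) (germ_addE (germ_add f g) h) _.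
2: apply: filterI (germ_addE g h) (germ_addE f g).
by move=> z -> -> [-> ->]; rewrite addrA.
Qed.

Lemma germ_addC : commutative germ_add.
Proof.
move=> f g; apply: germ_eqP.
by apply: filterS2 (germ_addE f g) (germ_addE g f) => z -> ->; rewrite addrC.
Qed.

Lemma germ_add0 : left_id germ0 germ_add.
Proof.
move=> f; apply: germ_eqP.
by apply: filterS2 (germ_addE germ0 f) germ0E => z -> ->; rewrite add0r.
Qed.

Lemma germ_addN : left_inverse germ0 germ_opp germ_add.
Proof.
move=> f; apply: germ_eqP.
apply: filterS3 (germ_addE (germ_opp f) f) (germ_oppE f) germ0E.
by move=> z -> -> ->; rewrite addNr.
Qed.

HB.instance Definition _ := GRing.isZmodule.Build (germ V)
  germ_addA germ_addC germ_add0 germ_addN.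

Lemma repr_germD (f g : germ V) :
  \forall z \near zeta, repr (f + g) z = repr f z + repr g z.
Proof. exact: germ_addE. Qed.
End Module.

Section Ring.

Definition germ1 : germ K^o :=
  \pi_(germ K^o) (Holo (holomorphic_at_cst (1 : K^o))).
Definition germ_mul (f g : germ K^o) : germ K^o := germ_scale f g.

Lemma germ1E : \forall z \near zeta, repr germ1 z = 1.
Proof. exact: germ_repr. Qed.

Lemma germ_mulE (f g : germ K^o) :
  \forall z \near zeta, repr (germ_mul f g) z = repr f z * repr g z.
Proof. exact: germ_scaleE. Qed.

Lemma germ_mulA : associative germ_mul.
Proof.
move=> f g h; apply: germ_eqP; near=> z.
rewrite (near (germ_mulE f (germ_mul g h)) z) //.
rewrite (near (germ_mulE (germ_mul f g) h) z) //.
rewrite (near (germ_mulE g h) z) // (near (germ_mulE f g) z) //.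
by rewrite mulrA.
Unshelve. all: by end_near. Qed.

Lemma germ_mulC : commutative germ_mul.
Proof.
move=> f g; apply: germ_eqP; near=> z.
rewrite (near (germ_mulE f g) z) // (near (germ_mulE g f) z) //.
by rewrite mulrC.
Unshelve. all: by end_near. Qed.

Lemma germ_mul1 : left_id germ1 germ_mul.
Proof.
move=> f; apply: germ_eqP; near=> z.
by rewrite (near (germ_mulE germ1 f) z) // (near germ1E z) // mul1r.
Unshelve. all: by end_near. Qed.

Lemma germ_mulDl : left_distributive germ_mul +%R.
Proof.
move=> f g h; apply: germ_eqP; near=> z.
rewrite (near (germ_mulE (f + g) h) z) // (near (repr_germD f g) z) //.
rewrite (near (repr_germD (germ_mul f h) (germ_mul g h)) z) //.
rewrite (near (germ_mulE f h) z) // (near (germ_mulE g h) z) //.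
by rewrite mulrDl.
Unshelve. all: by end_near. Qed.

Lemma germ1_neq0 : germ1 != 0.
Proof.
apply/eqP => e; have : (1 : K) = 0.
  have := nbhs_singleton germ1E; rewrite e => <-.
  exact: nbhs_singleton (germ0E K^o).
by move/eqP; rewrite oner_eq0.
Qed.

HB.instance Definition _ := GRing.Zmodule_isComNzRing.Build (germ K^o)
  germ_mulA germ_mulC germ_mul1 germ_mulDl germ1_neq0.
End Ring.

Section Lmodule.
Variable V : normedModType K.

Lemma repr_germM (f g : germ K^o) :
  \forall z \near zeta, repr (f * g) z = repr f z * repr g z.
Proof. exact: germ_mulE. Qed.

Lemma germ_scaleA (a b : germ K^o) (f : germ V) :
  germ_scale a (germ_scale b f) = germ_scale (a * b) f.
Proof.
apply: germ_eqP; near=> z.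
rewrite (near (germ_scaleE a (germ_scale b f)) z) //.
rewrite (near (germ_scaleE b f) z) // (near (germ_scaleE (a * b) f) z) //.
by rewrite (near (repr_germM a b) z) // scalerA.
Unshelve. all: by end_near. Qed.

Lemma germ_scale1 : left_id 1 (@germ_scale V).
Proof.
move=> f; apply: germ_eqP; near=> z.
rewrite (near (germ_scaleE 1 f) z) //.
have -> : repr (1 : germ K^o) z = 1 by near: z; exact: germ1E.
by rewrite scale1r.
Unshelve. all: by end_near. Qed.

Lemma germ_scaleDr : right_distributive (@germ_scale V) +%R.
Proof.
move=> a f g; apply: germ_eqP; near=> z.
rewrite (near (germ_scaleE a (f + g)) z) // (near (repr_germD f g) z) //.
rewrite (near (repr_germD (germ_scale a f) (germ_scale a g)) z) //.
rewrite (near (germ_scaleE a f) z) // (near (germ_scaleE a g) z) //.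
by rewrite scalerDr.
Unshelve. all: by end_near. Qed.

Lemma germ_scaleDl (f : germ V) : {morph (@germ_scale V)^~ f : a b / a + b}.
Proof.
move=> a b; apply: germ_eqP; near=> z.
rewrite (near (germ_scaleE (a + b) f) z) // (near (repr_germD a b) z) //.
rewrite (near (repr_germD (germ_scale a f) (germ_scale b f)) z) //.
rewrite (near (germ_scaleE a f) z) // (near (germ_scaleE b f) z) //.
by rewrite scalerDl.
Unshelve. all: by end_near. Qed.

HB.instance Definition _ := GRing.Zmodule_isLmodule.Build (germ K^o) (germ V)
  germ_scaleA germ_scale1 germ_scaleDr germ_scaleDl.

Lemma repr_germZ (k : germ K^o) (f : germ V) :
  \forall z \near zeta, repr (k *: f) z = repr k z *: repr f z.
Proof. exact: germ_scaleE. Qed.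
End Lmodule.
End Germs.

Section FreeModules.
Variables (A : nzRingType) (M : lmodType A).

(* No bound is put on the cardinality of [B]; linear combinations are finite,
   and their coefficients are the values of [c] on the finite set [s]. *)
Definition spanning (B : set M) : Prop :=
  forall x : M, exists (s : {fset M}) (c : M -> A),
    [set` s] `<=` B /\ x = \sum_(b <- s) c b *: b.

Definition linearly_independent (B : set M) : Prop :=
  forall (s : {fset M}) (c : M -> A), [set` s] `<=` B ->
    \sum_(b <- s) c b *: b = 0 -> forall b, b \in s -> c b = 0.

Definition is_basis (B : set M) : Prop := spanning B /\ linearly_independent B.

Definition free_module : Prop := exists B : set M, is_basis B.
End FreeModules.

Definition finite_dimensional (K : fieldType) (V : lmodType K) : Prop :=
  exists2 B : set V, finite_set B & is_basis B.

Definition infinite_dimensional (K : fieldType) (V : lmodType K) : Prop :=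
  ~ finite_dimensional V.

(* Main.v *)
Require Import Defs.
From mathcomp Require Import all_boot all_order all_algebra.
From mathcomp Require Import generic_quotient finmap complex ring lra.
From mathcomp Require Import all_classical all_reals all_analysis.

Set Implicit Arguments.
Unset Strict Implicit.
Unset Printing Implicit Defensive.

(* Let [t] be a coordinate of [C^m] at [zeta], and let [f] map the germs into a
   free module.  If the constant germs did not have their images in the span of
   finitely many basis elements, one could choose inductively unit constants
   [e_k], distinct basis elements [b_k] and a rapidly growing sequence [n_k]
   such that the [b_k]-coordinate of [f (sum_j t^n_j e_j)] is [t^n_k] times that
   of [f e_k] modulo [t^n_(k+1)], hence nonzero: infinitely many coordinates of
   one vector would be nonzero.  So [f] maps the constants into a free module of
   some finite rank [n], and [n + 1] linearly independent constants, which are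
   independent over the ring of germs, have images satisfying a nontrivial
   relation; [f] is not injective.

   The only input from complex analysis is that a scalar germ divisible by all
   the powers of [t] is zero.  On complex lines through [zeta] this follows from
   Cauchy's estimate.  The contour integrals are replaced by midpoint sums along
   the boundaries of squares, which are exactly additive under subdivision and
   vanish on affine functions: this is all that Goursat's bisection needs. *)

Import Order.TTheory GRing.Theory Num.Theory.
Import numFieldNormedType.Exports.
Import ComplexField ComplexField.Normc.

Local Open Scope classical_set_scope.
Local Open Scope ring_scope.

(** * Cauchy's estimate on a square *)

Section ComplexAnalysis.
Local Open Scope complex_scope.
Variable R : realType.
Local Notation C := R[i].
Local Notation normc := (@Normc.normc R).
Implicit Types (f g h : C -> C) (a b v w y z : C).

(* Midpoint Riemann sum, with [2 ^ n] nodes, of the integral of [g] along the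
   segment from [b] to [b + v]. *)
Fixpoint edge_sum g n b v : C :=
  if n is n'.+1 then edge_sum g n' b (v / 2) + edge_sum g n' (b + v / 2) (v / 2)
  else v * g (b + v / 2).

(* Counterclockwise around the square of corners [a], [a + v], [a + v + 'i * v]
   and [a + 'i * v]; [v] is complex, so the square may be rotated. *)
Definition square_sum g n a v : C :=
  edge_sum g n a v + edge_sum g n (a + v) ('i * v)
  - edge_sum g n (a + 'i * v) v - edge_sum g n a ('i * v).

Lemma normcR (x : R) : normc x%:C = `|x|.
Proof. by rewrite /= expr0n /= addr0 sqrtr_sqr. Qed.

Lemma normc_nat n : normc n%:R = n%:R.
Proof. by rewrite -[n%:R](rmorph_nat (real_complex R)) normcR ger0_norm. Qed.

Lemma normc_ge0 z : 0 <= normc z.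
Proof. by case: z => x y; exact: sqrtr_ge0. Qed.

Lemma edge_sum_lin f g (k : C) n b v :
  edge_sum (fun z => f z + k * g z) n b v = edge_sum f n b v + k * edge_sum g n b v.
Proof.
by elim: n b v => [|n IH] b v /=; rewrite ?IH; ring.
Qed.

Lemma edge_sum_affine (c d : C) n b v :
  edge_sum (fun z => c + d * z) n b v = v * (c + d * (b + v / 2)).
Proof.
by elim: n b v => [|n IH] b v //=; rewrite ?IH; field.
Qed.

Lemma edge_sum_rev g n b v : edge_sum g n (b + v) (- v) = - edge_sum g n b v.
Proof.
elim: n b v => [|n IH] b v /=.
  by rewrite mulNr; congr (- (_ * g _)); field.
have -> : b + v = b + v / 2 + v / 2 by field.
rewrite mulNr IH addrK IH; ring.
Qed.

(** The same square read from its next corner; iterating brings any chosen corner to the front. *)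
Lemma square_sum_rot g n a v :
  square_sum g n (a + v) ('i * v) = square_sum g n a v.
Proof.
have i2 : 'i * ('i * v) = - v by rewrite mulrA -expr2 sqr_i mulN1r.
rewrite /square_sum i2 addrK.
have -> : a + v + 'i * v = a + 'i * v + v by ring.
by rewrite !edge_sum_rev; ring.
Qed.

(** Each inner edge is traversed twice in opposite directions, at the same level and hence with the
    same nodes, so it cancels. *)
Lemma square_sum_split g n a v : square_sum g n.+1 a v =
  square_sum g n a (v / 2) + square_sum g n (a + v / 2) (v / 2)
  + square_sum g n (a + 'i * (v / 2)) (v / 2)
  + square_sum g n (a + v / 2 + 'i * (v / 2)) (v / 2).
Proof.
rewrite /square_sum /=.
have -> : 'i * v / 2 = 'i * (v / 2) by ring.
have -> : a + v + 'i * (v / 2) = a + v / 2 + 'i * (v / 2) + v / 2 by field.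
have -> : a + 'i * v + v / 2 = a + v / 2 + 'i * (v / 2) + 'i * (v / 2) by field.
have -> : a + v = a + v / 2 + v / 2 by field.
have -> : a + 'i * v = a + 'i * (v / 2) + 'i * (v / 2) by field.
have -> : a + 'i * (v / 2) + v / 2 = a + v / 2 + 'i * (v / 2) by ring.
ring.
Qed.

Lemma square_sum_lin f g (k : C) n a v :
  square_sum (fun z => f z + k * g z) n a v =
    square_sum f n a v + k * square_sum g n a v.
Proof. by rewrite /square_sum !edge_sum_lin; ring. Qed.

Lemma square_sum_affine (c d : C) n a v :
  square_sum (fun z => c + d * z) n a v = 0.
Proof.
by rewrite /square_sum !edge_sum_affine; field.
Qed.

Lemma edge_sum_le g n b v (M : R) :
  (forall s : R, 0 <= s <= 1 -> normc (g (b + s%:C * v)) <= M) ->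
  normc (edge_sum g n b v) <= M * normc v.
Proof.
have nc2 u : normc (u / 2) = normc u / 2.
  rewrite normcM normcV.
  by rewrite normc_nat.
have c2 (s : R) : (s / 2)%:C = s%:C / 2.
  by rewrite rmorphM /= fmorphV rmorph_nat.
elim: n b v => [|n IH] b v H /=.
  rewrite normcM mulrC; apply: ler_wpM2r.
    exact: normc_ge0.
  have -> : v / 2 = (1 / 2 : R)%:C * v by rewrite c2 rmorph1; ring.
  by apply: H; lra.
apply: le_trans (le_normcD _ _) _.
have -> : M * normc v = M * normc (v / 2) + M * normc (v / 2) by rewrite nc2; field.
apply: lerD; apply: IH => s sP.
  have -> : s%:C * (v / 2) = (s / 2)%:C * v by rewrite c2; ring.
  by apply: H; lra.
have -> : b + v / 2 + s%:C * (v / 2) = b + ((1 + s) / 2)%:C * v.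
  by rewrite c2 rmorphD rmorph1; ring.
by apply: H; lra.
Qed.

Lemma Complex_split (x y : R) : x +i* y = x%:C + 'i * y%:C.
Proof. exact: complexE (x +i* y). Qed.

Lemma normc_le_ReIm (x y : R) : normc (x +i* y) <= `|x| + `|y|.
Proof.
rewrite Complex_split; apply: le_trans (le_normcD _ _) _.
rewrite normcM !normcR.
have -> : normc 'i = 1 by rewrite /= expr0n expr1n /= add0r sqrtr1.
by rewrite mul1r.
Qed.

Definition closed_square a v z := exists x y : R,
  [/\ 0 <= x <= 1, 0 <= y <= 1 & z = a + v * (x +i* y)].

Definition square_boundary a v z := exists x y : R,
  [/\ 0 <= x <= 1, 0 <= y <= 1, [|| x == 0, x == 1, y == 0 | y == 1]
    & z = a + v * (x +i* y)].

Lemma square_boundaryW a v z : square_boundary a v z -> closed_square a v z.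
Proof. by move=> [x [y [? ? _ ?]]]; exists x, y. Qed.

Lemma square_sum_le g n a v (M : R) :
  (forall z, square_boundary a v z -> normc (g z) <= M) ->
  normc (square_sum g n a v) <= 4 * M * normc v.
Proof.
move=> H.
have nci : normc ('i * v) = normc v.
  rewrite normcM.
  by rewrite [normc 'i]/= expr0n expr1n /= add0r sqrtr1 mul1r.
have e1 : normc (edge_sum g n a v) <= M * normc v.
  apply: edge_sum_le => s s01; apply: H; exists s, 0; split; rewrite ?eqxx ?orbT//.
    lra.
  by rewrite mulrC complexr0.
have e2 : normc (edge_sum g n (a + v) ('i * v)) <= M * normc v.
  rewrite -nci; apply: edge_sum_le => s s01.
  apply: H; exists 1, s; split; rewrite ?eqxx ?orbT//; first lra.
  by rewrite Complex_split rmorph1; ring.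
have e3 : normc (edge_sum g n (a + 'i * v) v) <= M * normc v.
  apply: edge_sum_le => s s01.
  apply: H; exists s, 1; split; rewrite ?eqxx ?orbT//; first lra.
  by rewrite Complex_split rmorph1; ring.
have e4 : normc (edge_sum g n a ('i * v)) <= M * normc v.
  rewrite -nci; apply: edge_sum_le => s s01.
  apply: H; exists 0, s; split; rewrite ?eqxx ?orbT//; first lra.
  by rewrite Complex_split rmorph0; ring.
rewrite /square_sum.
apply: le_trans (le_normcD _ _) _; rewrite normcN.
have := le_normcD (edge_sum g n a v + edge_sum g n (a + v) ('i * v))
  (- edge_sum g n (a + 'i * v) v).
have := le_normcD (edge_sum g n a v) (edge_sum g n (a + v) ('i * v)).
rewrite normcN; lra.
Qed.

(** * Goursat's theorem by bisection *)

(** Complex differentiability at [q] with real radii and no filters, the form used by the estimates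
    on squares. *)
Definition first_order g q := exists d, forall e : R, 0 < e ->
  exists2 dl : R, 0 < dl &
    forall z, normc (z - q) < dl ->
      normc (g z - g q - d * (z - q)) <= e * normc (z - q).

(** Takes the place of a bound on the modulus of the integral, so that no limit of the sums has to
    exist. *)
Definition eventually_le g a v (c : R) :=
  exists N, forall n, (N <= n)%N -> normc (square_sum g n a v) <= c.

Lemma eventually_le_split g a v (c1 c2 c3 c4 : R) :
  eventually_le g a (v / 2) c1 -> eventually_le g (a + v / 2) (v / 2) c2 ->
  eventually_le g (a + 'i * (v / 2)) (v / 2) c3 ->
  eventually_le g (a + v / 2 + 'i * (v / 2)) (v / 2) c4 ->
  eventually_le g a v (c1 + c2 + c3 + c4).
Proof.
move=> [N1 H1] [N2 H2] [N3 H3] [N4 H4].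
exists (maxn (maxn N1 N2) (maxn N3 N4)).+1 => -[//|n].
rewrite ltnS !geq_max => /andP[/andP[/H1 h1 /H2 h2] /andP[/H3 h3 /H4 h4]].
rewrite square_sum_split.
do 3![apply: le_trans (le_normcD _ _) _; apply: lerD => //].
Qed.

Lemma div_exp2_lt (B e : R) : 0 < e -> exists j : nat, B / 2 ^+ j < e.
Proof.
move=> e0; pose N := Num.bound (B / e); exists N.
have [B0|B0] := lerP B 0.
  by apply: le_lt_trans e0; rewrite pmulr_lle0 // invr_gt0 exprn_gt0.
rewrite ltr_pdivrMr ?exprn_gt0 // mulrC -ltr_pdivrMr //.
apply: lt_le_trans (archi_boundP _) _; first exact/ltW/divr_gt0.
by rewrite -/N -natrX ler_nat ltnW // ltn_expl.
Qed.

(** The intervals from [u j] to [u j + 2^-j] are nested; [X] is the supremum of their left ends. *)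
Lemma nested_limit (u : nat -> R) :
  (forall j, u j <= u j.+1 <= u j + (2 ^+ j.+1)^-1) ->
  exists X, forall j, u j <= X <= u j + (2 ^+ j)^-1.
Proof.
move=> H.
have up j k : u j <= u (j + k)%N.
  elim: k => [|k IH]; first by rewrite addn0.
  by rewrite addnS (le_trans IH) //; have /andP[] := H (j + k)%N.
have dn j k : u (j + k)%N + (2 ^+ (j + k))^-1 <= u j + (2 ^+ j)^-1.
  elim: k => [|k IH]; first by rewrite addn0.
  apply: le_trans IH; rewrite addnS; have /andP[_] := H (j + k)%N.
  have -> : (2 ^+ (j + k))^-1 = (2 ^+ (j + k).+1)^-1 *+ 2 :> R.
    by rewrite exprS; field; rewrite expf_neq0 // pnatr_eq0.
  rewrite mulr2n; lra.
have ub j k : u k <= u j + (2 ^+ j)^-1.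
  have [jk|/ltnW kj] := leqP j k.
    apply: le_trans (dn j (k - j)%N); rewrite subnKC // lerDl invr_ge0.
    exact: exprn_ge0.
  apply: le_trans (up k (j - k)%N) _; rewrite subnKC // lerDl invr_ge0.
  exact: exprn_ge0.
exists (sup (range u)) => j; apply/andP; split.
  by apply: ub_le_sup; [exists (u 0%N + (2 ^+ 0)^-1) => _ [k _ <-] | exists j].
by apply: ge_sup; [exists (u j), j | move=> _ [k _ <-]].
Qed.

(** By contradiction: bisection gives nested squares whose sums are not eventually below [c / 4^j].
    Near their common point [q] the affine part of [g] contributes nothing and the remainder is too
    small. *)
Lemma goursat g a v :
  (forall z, closed_square a v z -> first_order g z) ->
  forall c : R, 0 < c -> eventually_le g a v c.
Proof.
move=> Hg c c0; apply: contrapT => nle.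
(* Squares are tracked by the coordinates of their first corner relative to the initial square. *)
pose cor (p : R * R) := a + v * (p.1 +i* p.2).
pose bad (j : nat) (p : R * R) :=
  ~ eventually_le g (cor p) (v / 2 ^+ j) (c / 4 ^+ j).
pose near_ (j : nat) (x x' : R) := x <= x' <= x + (2 ^+ j.+1)^-1.
(* The implication stands under the existential so that choice yields a total selection function. *)
have step (jp : nat * (R * R)) : exists p', bad jp.1 jp.2 ->
    [/\ bad jp.1.+1 p', near_ jp.1 jp.2.1 p'.1 & near_ jp.1 jp.2.2 p'.2].
  case: jp => j [x y] /=; apply: contrapT => /forallNP nex.
  have [bd|nbd] := pselect (bad j (x, y)); last by have := nex (x, y); tauto.
  apply: bd.
  have -> : c / 4 ^+ j =
      c / 4 ^+ j.+1 + c / 4 ^+ j.+1 + c / 4 ^+ j.+1 + c / 4 ^+ j.+1.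
    by rewrite exprS invfM; field; rewrite expf_neq0 // pnatr_eq0.
  have dv : v / 2 ^+ j / 2 = v / 2 ^+ j.+1.
    by rewrite exprS; field; rewrite expf_neq0 // pnatr_eq0.
  pose h : R := (2 ^+ j.+1)^-1.
  have h0 : 0 <= h by rewrite invr_ge0 exprn_ge0.
  have hC : v / 2 ^+ j.+1 = v * h%:C.
    by rewrite /h fmorphV rmorphXn rmorph_nat.
  have key (p : R * R) : near_ j x p.1 -> near_ j y p.2 ->
      eventually_le g (cor p) (v / 2 ^+ j.+1) (c / 4 ^+ j.+1).
    move=> n1 n2; apply: contrapT => bp; apply: (nex p) => _; split => //.
  have corE (s t : R) : cor (x + s, y + t) = cor (x, y) + v * s%:C + 'i * (v * t%:C).
    rewrite /cor /= !Complex_split !rmorphD.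
    ring.
  apply: eventually_le_split; rewrite dv.
  - by apply: key; rewrite /near_ /= -/h; lra.
  - have <- : cor (x + h, y + 0) = cor (x, y) + v / 2 ^+ j.+1.
      by rewrite corE hC rmorph0 !mulr0 addr0.
    by apply: key; rewrite /near_ /= -/h; lra.
  - have <- : cor (x + 0, y + h) = cor (x, y) + 'i * (v / 2 ^+ j.+1).
      by rewrite corE hC rmorph0 mulr0 addr0.
    by apply: key; rewrite /near_ /= -/h; lra.
  - have <- : cor (x + h, y + h)
        = cor (x, y) + v / 2 ^+ j.+1 + 'i * (v / 2 ^+ j.+1).
      by rewrite corE hC.
    by apply: key; rewrite /near_ /= -/h; lra.
have [f Hf] := choice step.
pose p_ := fix p_ j := if j is j'.+1 then f (j', p_ j') else (0, 0) : R * R.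
have badp j : bad j (p_ j).
  elim: j => [|j IH].
    rewrite /bad /= !expr0 !divr1 /cor /=.
    by have -> : a + v * (0 +i* 0) = a by rewrite complexr0 rmorph0 mulr0 addr0.
  by have [] := Hf (j, p_ j) IH.
have [X HX] : exists X, forall j, (p_ j).1 <= X <= (p_ j).1 + (2 ^+ j)^-1.
  apply: (@nested_limit (fun j => (p_ j).1)) => j.
  by have [] := Hf (j, p_ j) (badp j).
have [Y HY] : exists Y, forall j, (p_ j).2 <= Y <= (p_ j).2 + (2 ^+ j)^-1.
  apply: (@nested_limit (fun j => (p_ j).2)) => j.
  by have [] := Hf (j, p_ j) (badp j).
pose q := a + v * (X +i* Y).
have [d Hd] : first_order g q.
  apply: Hg; exists X, Y; split => //.
    by have := HX 0%N; rewrite expr0 invr1 add0r.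
  by have := HY 0%N; rewrite expr0 invr1 add0r.
have v0 := normc_ge0 v.
(* With [h = 2^-j], the final bound is [8 e |v|^2 h^2], which must not exceed [c h^2]; the [+ 1]
   covers [v = 0]. *)
pose e := c / (8 * (normc v ^+ 2 + 1)).
have e0 : 0 < e by rewrite divr_gt0 // mulr_gt0 // ltr_wpDl // sqr_ge0.
have [dl dl0 Hdl] := Hd e e0.
(* All points of the square of generation [j] are within [2 |v| / 2^j] of [q]. *)
have [j Hj] := div_exp2_lt (2 * normc v) dl0.
apply: (badp j); exists 0%N => n _.
pose h : R := (2 ^+ j)^-1.
have h0 : 0 <= h by rewrite invr_ge0 exprn_ge0.
have hC : v / 2 ^+ j = v * h%:C.
  by rewrite /h fmorphV rmorphXn rmorph_nat.
(* Subtracting the first-order Taylor polynomial at [q] does not change the sum. *)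
have -> : square_sum g n (cor (p_ j)) (v / 2 ^+ j) =
  square_sum (fun z => g z + (-1) * ((g q - d * q) + d * z)) n
    (cor (p_ j)) (v / 2 ^+ j).
  by rewrite square_sum_lin square_sum_affine mulr0 addr0.
apply: le_trans (_ : 4 * (e * (normc v * (2 * h))) * normc (v / 2 ^+ j) <= _).
  apply: square_sum_le => z /square_boundaryW [s [t [s01 t01 zE]]].
  have zq : normc (z - q) <= normc v * (2 * h).
    have -> : z - q = v * (((p_ j).1 + h * s - X) +i* ((p_ j).2 + h * t - Y)).
      rewrite zE hC /q /cor !Complex_split.
      rewrite !(rmorphB, rmorphD, rmorphM) /=; ring.
    rewrite normcM ler_wpM2l //.
    apply: le_trans (normc_le_ReIm _ _) _.
    have := HX j; have := HY j; rewrite -/h => hY hX.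
    have hs : 0 <= h * s <= h by rewrite mulr_ge0 ?ler_piMr //; lra.
    have ht : 0 <= h * t <= h by rewrite mulr_ge0 ?ler_piMr //; lra.
    have : `|(p_ j).1 + h * s - X| <= h by rewrite ler_norml; lra.
    have : `|(p_ j).2 + h * t - Y| <= h by rewrite ler_norml; lra.
    lra.
  have -> : g z + -1 * (g q - d * q + d * z) = g z - g q - d * (z - q) by ring.
  apply: le_trans (Hdl z _) _.
    apply: le_lt_trans zq _.
    by rewrite mulrCA mulrA.
  by rewrite ler_pM2l.
rewrite hC normcM normcR ger0_norm //.
have -> : c / 4 ^+ j = c * h ^+ 2.
  have -> : 4 = 2 ^+ 2 :> R by rewrite -natrX.
  by rewrite /h exprVn -!exprM mulnC.
have -> : 4 * (e * (normc v * (2 * h))) * (normc v * h) =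
    8 * e * normc v ^+ 2 * h ^+ 2.
  ring.
apply: ler_wpM2r; first exact: sqr_ge0.
have -> : 8 * e * normc v ^+ 2 = c * (normc v ^+ 2 / (normc v ^+ 2 + 1)).
  rewrite /e; field; rewrite gt_eqF //; rewrite ltr_wpDl // sqr_ge0 //.
apply: ler_piMr; first exact: ltW.
rewrite ler_pdivrMr ?mul1r ?lerDl //.
by rewrite ltr_wpDl // sqr_ge0.
Qed.

(** * Goursat's theorem with an exceptional point *)

Lemma sqr_iC : 'i * 'i = -1 :> C.
Proof. by rewrite -expr2 sqr_i. Qed.

Lemma square_sum_rot2 g n a v :
  square_sum g n (a + v + 'i * v) (- v) = square_sum g n a v.
Proof.
rewrite -(square_sum_rot g n a) -(square_sum_rot g n (a + v)); congr square_sum.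
by rewrite mulrA sqr_iC mulN1r.
Qed.

Lemma square_sum_rot3 g n a v :
  square_sum g n (a + 'i * v) (- ('i * v)) = square_sum g n a v.
Proof.
rewrite -(square_sum_rot2 g n a) -(square_sum_rot g n (a + v + 'i * v)).
by congr square_sum; ring.
Qed.

Lemma eventually_leW g a v (c c' : R) :
  c <= c' -> eventually_le g a v c -> eventually_le g a v c'.
Proof. by move=> cc' [N H]; exists N => n /H /le_trans; apply. Qed.

Lemma eventually_le_eq g a a' v v' (c : R) :
  (forall n, square_sum g n a v = square_sum g n a' v') ->
  eventually_le g a v c -> eventually_le g a' v' c.
Proof. by move=> E [N H]; exists N => n /H; rewrite E. Qed.

Lemma complex_gt0_neq0 (x y : R) : 0 < x \/ 0 < y -> x +i* y != 0.
Proof.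
by move=> H; apply/eqP => -[x0 y0]; move: H; rewrite x0 y0 ltxx; case.
Qed.

(* The square splits into the half-size square at the exceptional corner [0] and
   three squares on which Goursat's theorem applies; iterating, only a square of
   arbitrarily small perimeter counts. *)
Lemma goursat_corner g v : v != 0 ->
  (forall z, closed_square 0 v z -> z != 0 -> first_order g z) ->
  (exists M dl : R, 0 < dl /\ forall z, normc z < dl -> normc (g z) <= M) ->
  forall c : R, 0 < c -> eventually_le g 0 v c.
Proof.
move=> v0 Hg [M [dl [dl0 HM]]] c c0.
(* One quartering per induction step: a quarter of [e] pays for each of the three squares away from
   0, and a quarter is left for the smaller scales. *)
have shrink j (c' e : R) : 0 < e -> eventually_le g 0 (v / 2 ^+ j) c' ->
    eventually_le g 0 v (c' + e).
  elim: j v v0 Hg e => [|j IH] {}v v0 Hg e e0.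
    by rewrite expr0 divr1; apply: eventually_leW; rewrite lerDl ltW.
  have v20 : v / 2 != 0 by rewrite mulf_neq0 // invr_eq0 pnatr_eq0.
  have half (x y : R) : v / 2 * (x +i* y) = v * ((x / 2) +i* (y / 2)).
    by rewrite !Complex_split !rmorphM /= !fmorphV !rmorph_nat; ring.
  have Hg2 z : closed_square 0 (v / 2) z -> z != 0 -> first_order g z.
    move=> [x [y [x01 y01 ->]]]; apply: Hg; exists (x / 2), (y / 2).
    by split; [lra | lra | rewrite half].
  rewrite exprS invfM mulrA => /(IH _ v20 Hg2) Hj.
  have far (p q x y : R) : 0 <= x <= 1 -> 0 <= y <= 1 ->
      0 <= p <= 1 -> 0 <= q <= 1 -> 0 < p \/ 0 < q ->
      first_order g (v / 2 * ((p + x) +i* (q + y))).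
    move=> x01 y01 p01 q01 pq; apply: Hg.
      by exists ((p + x) / 2), ((q + y) / 2); split; [lra|lra|rewrite half add0r].
    apply: mulf_neq0 => //; apply: complex_gt0_neq0.
    by case: pq => ?; [left|right]; lra.
  have -> : c' + e = (c' + e / 4) + e / 4 + e / 4 + e / 4 by field.
  apply: eventually_le_split.
  - by apply: Hj => //; lra.
  - apply: goursat; last lra; move=> z [x [y [x01 y01 ->]]].
    have -> : 0 + v / 2 + v / 2 * (x +i* y) = v / 2 * ((1 + x) +i* (0 + y)).
      by rewrite !Complex_split !rmorphD rmorph0 rmorph1; ring.
    by apply: far => //; [lra|lra|left].
  - apply: goursat; last lra; move=> z [x [y [x01 y01 ->]]].
    have -> : 0 + 'i * (v / 2) + v / 2 * (x +i* y) = v / 2 * ((0 + x) +i* (1 + y)).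
      by rewrite !Complex_split !rmorphD rmorph0 rmorph1; ring.
    by apply: far => //; [lra|lra|right].
  - apply: goursat; last lra; move=> z [x [y [x01 y01 ->]]].
    have -> : 0 + v / 2 + 'i * (v / 2) + v / 2 * (x +i* y)
        = v / 2 * ((1 + x) +i* (1 + y)).
      by rewrite !Complex_split !rmorphD rmorph1; ring.
    by apply: far => //; [lra|lra|left].
(* [j] puts the small square in the disc where [M] bounds [g]; [l] makes its perimeter times [|M|]
   less than [c / 2]. *)
have [j Hj] := div_exp2_lt (2 * normc v) dl0.
have c20 : 0 < c / 2 by lra.
have [l Hl] := div_exp2_lt (4 * `|M| * normc v) c20.
pose N := maxn j l.
have mono (B : R) i : 0 <= B -> (i <= N)%N -> B / 2 ^+ N <= B / 2 ^+ i.
  move=> B0 iN; apply: ler_wpM2l => //; rewrite lef_pV2 ?posrE ?exprn_gt0 //.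
  by rewrite ler_eXn2l // ltr1n.
have ncN : normc (v / 2 ^+ N) = normc v / 2 ^+ N.
  rewrite normcM normcV -natrX normc_nat.
  by rewrite natrX.
have -> : c = c / 2 + c / 2 by field.
apply: (shrink N) => //; exists 0%N => n _.
apply: le_trans (_ : 4 * `|M| * normc (v / 2 ^+ N) <= _).
  apply: square_sum_le => z /square_boundaryW[x [y [x01 y01 ->]]].
  apply: le_trans (ler_norm _); apply: HM.
  rewrite add0r normcM ncN.
  apply: le_lt_trans Hj.
  apply: le_trans (mono _ _ _ (leq_maxl _ _)); last first.
    by rewrite mulr_ge0 // normc_ge0.
  rewrite mulrC -mulrA; apply: ler_wpM2r.
    by rewrite divr_ge0 // ?normc_ge0 // exprn_ge0.
  apply: le_trans (normc_le_ReIm _ _) _.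
  by rewrite !ger0_norm; lra.
rewrite ncN mulrA; apply: le_trans (ltW Hl).
apply: mono; first by rewrite !mulr_ge0 ?normc_ge0.
exact: leq_maxr.
Qed.

(** The centred square is cut into four, each with the exceptional point 0 at a corner; changing the
    starting corner makes 0 the first one. *)
Lemma goursat_center g w : w != 0 ->
  (forall z, closed_square (- w - 'i * w) (2 * w) z -> z != 0 ->
    first_order g z) ->
  (exists M dl : R, 0 < dl /\ forall z, normc z < dl -> normc (g z) <= M) ->
  forall c : R, 0 < c -> eventually_le g (- w - 'i * w) (2 * w) c.
Proof.
move=> w0 Hg Hb c c0.
have i0 : 'i != 0 :> C by rewrite eq_complex /= oner_eq0 andbF.
have mem (s t : R) : -1 <= s <= 1 -> -1 <= t <= 1 ->
    closed_square (- w - 'i * w) (2 * w) (w * (s +i* t)).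
  move=> s1 t1; exists ((1 + s) / 2), ((1 + t) / 2); split; [lra|lra|].
  rewrite !Complex_split !(rmorphM, rmorphD) /= !fmorphV !rmorph_nat !rmorph1.
  by field.
(* The quarter with first corner 0 and first edge [u * w], where [u] will be -1, -i, i and 1. *)
have corner u : u != 0 ->
    (forall x y : R, 0 <= x <= 1 -> 0 <= y <= 1 -> exists s t : R,
      [/\ -1 <= s <= 1, -1 <= t <= 1 & u * (x +i* y) = s +i* t]) ->
    forall e : R, 0 < e -> eventually_le g 0 (u * w) e.
  move=> u0 Hu; apply: goursat_corner => //; first exact: mulf_neq0.
  move=> z [x [y [x01 y01 ->]]]; apply: Hg.
  have [s [t [s1 t1 E]]] := Hu x y x01 y01.
  by rewrite add0r mulrAC E [(s +i* t) * w]mulrC; exact: mem.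
have w2 : 2 * w / 2 = w by field.
have -> : c = c / 4 + c / 4 + c / 4 + c / 4 by field.
have c40 : 0 < c / 4 by lra.
apply: eventually_le_split; rewrite w2.
- apply: (@eventually_le_eq _ 0 _ (- w)).
    by move=> n; rewrite -[RHS]square_sum_rot2; congr square_sum; ring.
  rewrite -mulN1r; apply: corner; [by rewrite oppr_eq0 oner_eq0| |by []].
  move=> x y x01 y01; exists (- x), (- y); split; [lra|lra|].
  by rewrite mulN1r.
- apply: (@eventually_le_eq _ 0 _ (- ('i * w))).
    by move=> n; rewrite -[RHS]square_sum_rot3; congr square_sum; ring.
  rewrite -mulNr; apply: corner; [by rewrite oppr_eq0| |by []].
  move=> x y x01 y01; exists y, (- x); split; [lra|lra|].
  by rewrite mulNr; simpc.
- apply: (@eventually_le_eq _ 0 _ ('i * w)).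
    by move=> n; rewrite -[RHS]square_sum_rot; congr square_sum; ring.
  apply: corner => //.
  by move=> x y x01 y01; exists (- y), x; split; [lra|lra|simpc].
- have -> : - w - 'i * w + w + 'i * w = 0 by ring.
  rewrite -[w]mul1r; apply: corner; rewrite ?oner_eq0 // => x y x01 y01.
  by exists x, y; split; [lra|lra|rewrite mul1r].
Qed.

(** * The integral of the inverse around a centred square *)

Lemma edge_sum_inv_rot n b v :
  edge_sum GRing.inv n ('i * b) ('i * v) = edge_sum GRing.inv n b v.
Proof.
have i0 : 'i != 0 :> C by rewrite eq_complex /= oner_eq0 andbF.
elim: n b v => [|n IH] b v /=.
  have -> : 'i * b + 'i * v / 2 = 'i * (b + v / 2) by ring.
  by rewrite invfM mulrACA divff // mul1r.
have -> : 'i * b + 'i * v / 2 = 'i * (b + v / 2) by ring.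
by rewrite -['i * v / 2]mulrA !IH.
Qed.

Lemma ImD y z : complex.Im (y + z) = complex.Im y + complex.Im z.
Proof. by case: y z => ? ? []. Qed.

Lemma Im_edge_sum_ge g n b (x m : R) :
  (forall s : R, 0 <= s <= 1 -> m <= complex.Im (g (b + s%:C * x%:C))) -> 0 <= x ->
  m * x <= complex.Im (edge_sum g n b x%:C).
Proof.
have ImM (s : R) z : complex.Im (s%:C * z) = s * complex.Im z.
  by case: z => p q /=; rewrite mul0r addr0.
have c2 (s : R) : s%:C / 2 = (s / 2)%:C.
  by rewrite rmorphM /= fmorphV rmorph_nat.
elim: n b x => [|n IH] b x H x0 /=.
  rewrite ImM mulrC; apply: ler_wpM2l => //.
  have -> : x%:C / 2 = (1 / 2 : R)%:C * x%:C by rewrite -c2 rmorph1; ring.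
  by apply: H; lra.
have -> : m * x = m * (x / 2) + m * (x / 2) by field.
rewrite c2 ImD; apply: lerD; (apply: IH; last by lra) => s s01.
  have -> : s%:C * (x / 2)%:C = (s / 2)%:C * x%:C by rewrite -!c2; ring.
  by apply: H; lra.
have -> : b + (x / 2)%:C + s%:C * (x / 2)%:C = b + ((1 + s) / 2)%:C * x%:C.
  by rewrite -!c2 rmorphD rmorph1; ring.
by apply: H; lra.
Qed.

Lemma Im_le_normc z : `|complex.Im z| <= normc z.
Proof.
case: z => x y /=; rewrite -sqrtr_sqr; apply: ler_wsqrtr.
by rewrite lerDr sqr_ge0.
Qed.

Lemma Re_le_normc z : `|complex.Re z| <= normc z.
Proof.
case: z => x y /=; rewrite -sqrtr_sqr; apply: ler_wsqrtr.
by rewrite lerDl sqr_ge0.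
Qed.

(** The four edges are rotations of the bottom one by powers of i, and [dz / z] is invariant under
    them, so their sums agree. On the bottom edge [Im (1 / z) = r / |z|^2] is at least [1 / (2 r)],
    over a length [2 r]. The bound 4 does the work of the exact modulus of the integral, 2 pi. *)
Lemma square_sum_inv_ge n (r : R) : 0 < r ->
  4 <= normc (square_sum GRing.inv n (- r%:C - 'i * r%:C) (2 * r%:C)).
Proof.
move=> r0; set a := - r%:C - 'i * r%:C; set v := 2 * r%:C.
have ii z : 'i * ('i * z) = - z by rewrite mulrA sqr_iC mulN1r.
have -> : square_sum GRing.inv n a v = edge_sum GRing.inv n a v *+ 4.
  rewrite /square_sum -(edge_sum_rev _ _ (a + _)) -(edge_sum_rev _ _ a).
  have ia : 'i * a = r%:C - 'i * r%:C.
    transitivity (- ('i * r%:C) - 'i * ('i * r%:C)); first by rewrite /a; ring.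
    by rewrite ii; ring.
  have -> : a + v = 'i * a by rewrite ia /a /v; ring.
  have -> : a + 'i * v + v = 'i * ('i * a) by rewrite ii /a /v; ring.
  have -> : a + 'i * v = 'i * ('i * ('i * a)).
    by rewrite ii ia /a /v; ring.
  have -> : - ('i * v) = 'i * ('i * ('i * v)) by rewrite ii.
  by rewrite -(ii v) !edge_sum_inv_rot; ring.
have vE : v = (2 * r)%:C by rewrite rmorphM rmorph_nat.
apply: le_trans (Im_le_normc _); apply: le_trans (ler_norm _).
have -> : complex.Im (edge_sum GRing.inv n a v *+ 4) =
    complex.Im (edge_sum GRing.inv n a v) *+ 4.
  by rewrite !mulrSr !ImD.
rewrite ler_wMn2r // vE.
have r2 : (2 * r)^-1 * (2 * r) = 1 by rewrite mulVf // gt_eqF //; lra.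
rewrite -[X in X <= _]r2; apply: Im_edge_sum_ge; last by lra.
move=> s s01.
have -> : a + s%:C * (2 * r)%:C = (r * (2 * s - 1)) +i* (- r).
  rewrite Complex_split /a; rewrite !(rmorphM, rmorphB, rmorphN) /=.
  by rewrite rmorph1 rmorph_nat; ring.
rewrite /= mulNr opprK.
have D : 0 < (r * (2 * s - 1)) ^+ 2 + (- r) ^+ 2.
  by rewrite ltr_wpDl ?sqr_ge0 // sqrrN exprn_gt0.
rewrite ler_pdivlMr // ler_pdivrMl ?mulr_gt0 //.
have s2 : 0 <= s * (1 - s) by rewrite mulr_ge0 //; lra.
have : 0 <= r ^+ 2 * (s * (1 - s)) by rewrite mulr_ge0 // sqr_ge0.
rewrite !expr2; nra.
Qed.

(** * Cauchy's estimate and zeros of infinite order *)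

Lemma normc_normE z : `|z| = (normc z)%:C.
Proof. by case: z. Qed.

Lemma derivable_first_order g q :
  derivable (g : C^o -> C^o) q 1 -> first_order g q.
Proof.
move=> /cvg_ex[/= d /cvgrPdist_le H]; exists d => e e0.
have e0C : 0 < e%:C :> C by rewrite ltcR.
have /nbhs_normP[dl /= dl0 Hdl] := H _ e0C.
(* A positive element of [R[i]] is real, so the radius equals its real part. *)
have dlE : (complex.Re dl)%:C = dl by apply: RRe_real; exact: gtr0_real.
exists (complex.Re dl); first by rewrite -ltcR dlE.
move=> z zq; have [->|zq0] := eqVneq z q.
  by rewrite !subrr mulr0 subrr normc0 mulr0.
have z0 : z - q != 0 by rewrite subr_eq0.
have := Hdl (z - q); rewrite /= sub0r normrN.
rewrite [X in X < _]normc_normE -dlE ltcR => /(_ zq z0).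
rewrite [_%:A]mulr1 subrK [X in X <= _]normc_normE lecR => K.
have -> : g z - g q - d * (z - q) =
    - (d - (z - q)^-1 *: (g z - g q : C^o)) * (z - q).
  by rewrite /GRing.scale /=; field.
by rewrite normcM normcN ler_wpM2r // normc_ge0.
Qed.

(** Centre 0 and side 6: the boundary lies between the circles of radii 3 and 6. *)
Definition square3 := closed_square (- 3%:C - 'i * 3%:C : C) (2 * 3%:C).

Lemma square3E (x y : R) : - 3%:C - 'i * 3%:C + 2 * 3%:C * (x +i* y)
  = (6 * x - 3) +i* (6 * y - 3) :> C.
Proof.
have -> : 6 = 2 * 3 :> R by lra.
by rewrite !Complex_split !(rmorphM, rmorphB) /= !rmorph_nat; ring.
Qed.

Lemma square3_le z : square3 z -> normc z <= 6.
Proof.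
move=> [x [y [x01 y01 ->]]]; rewrite square3E.
apply: le_trans (normc_le_ReIm _ _) _.
have : `|6 * x - 3| <= 3 by rewrite ler_norml; lra.
have : `|6 * y - 3| <= 3 by rewrite ler_norml; lra.
lra.
Qed.

Lemma square3_boundary z :
  square_boundary (- 3%:C - 'i * 3%:C) (2 * 3%:C) z -> 3 <= normc z <= 6.
Proof.
move=> zB; rewrite (square3_le (square_boundaryW zB)) andbT.
have [x [y [x01 y01 B ->]]] := zB; rewrite square3E.
case/or4P: B => /eqP ->.
- apply: le_trans (Re_le_normc _) => /=.
  by rewrite mulr0 sub0r normrN ger0_norm.
- apply: le_trans (Re_le_normc _) => /=.
  by rewrite ger0_norm; lra.
- apply: le_trans (Im_le_normc _) => /=.
  by rewrite mulr0 sub0r normrN ger0_norm.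
- apply: le_trans (Im_le_normc _) => /=.
  by rewrite ger0_norm; lra.
Qed.

(** The difference quotient of [h] at 0 has arbitrarily small sums, so the sums of [h z / z] are
    close to [h 0] times those of [1 / z]. The former are at most [4 * (M / 3) * 6 = 8 M], the
    latter have modulus at least 4. *)
Lemma cauchy_estimate h (M : R) :
  (forall z, normc z <= 6 -> derivable (h : C^o -> C^o) z 1) ->
  (forall z, 3 <= normc z <= 6 -> normc (h z) <= M) -> normc (h 0) <= 2 * M.
Proof.
move=> dh hM.
(* Bounded near [0], where division by zero gives it the value [0]. *)
pose g z := (h z - h 0) / z.
have Hg z : square3 z -> z != 0 -> first_order g z.
  move=> /square3_le z6 z0; apply: derivable_first_order.
  apply: (@derivableM _ _ (h - cst (h 0) : C^o -> C^o) (GRing.inv : C^o -> C^o)).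
    by apply: derivableB; [exact: dh|exact: derivable_cst].
  by apply: derivableV => //; exact: derivable_id.
have Hb : exists M dl : R, 0 < dl /\ forall z, normc z < dl -> normc (g z) <= M.
  have nc0 : normc 0 <= 6 by rewrite normc0; lra.
  have [d /(_ 1 ltr01)[dl dl0 Hdl]] := derivable_first_order (dh 0 nc0).
  exists (normc d + 1), dl; split => // z zdl; rewrite /g.
  have [->|z0] := eqVneq z 0.
    rewrite invr0 mulr0 normc0.
    by have := normc_ge0 d; lra.
  have -> : (h z - h 0) / z = d + (h z - h 0 - d * (z - 0)) / z by field.
  apply: le_trans (le_normcD _ _) _; apply: lerD => //.
  rewrite normcM normcV.
  have nz : 0 < normc z.
    rewrite lt_neqAle normc_ge0 andbT eq_sym.
    by apply: contra z0 => /eqP/eq0_normc ->.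
  rewrite ler_pdivrMr // mul1r.
  by have := Hdl z; rewrite subr0 mul1r; apply.
have w0 : (3%:C : C) != 0 by rewrite eq_complex /= negb_and pnatr_eq0.
apply/ler_addgt0Pr => e e0.
have [N HN] := goursat_center w0 Hg Hb e0.
have := HN N (leqnn N).
set a := _ - _; set v := 2 * _ => Hsq.
have E : square_sum (fun z => h z / z) N a v =
    square_sum g N a v + h 0 * square_sum GRing.inv N a v.
  rewrite -square_sum_lin; congr square_sum; apply/funext => z; rewrite /g; ring.
have Hq : normc (square_sum (fun z => h z / z) N a v) <= 4 * (M / 3) * normc v.
  apply: square_sum_le => z /square3_boundary /[dup] z36 /hM hz.
  rewrite normcM normcV.
  apply: ler_pM => //; rewrite ?invr_ge0 ?normc_ge0 //.
  by rewrite lef_pV2 ?posrE //; lra.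
have nv : normc v = 6.
  rewrite /v normcM normc_nat normcR ger0_norm //; lra.
have r30 : (0 : R) < 3 by lra.
have L := square_sum_inv_ge N r30.
have K : normc (h 0) * normc (square_sum GRing.inv N a v) <= 4 * (M / 3) * 6 + e.
  rewrite -normcM.
  have -> : h 0 * square_sum GRing.inv N a v =
      square_sum (fun z => h z / z) N a v - square_sum g N a v.
    by rewrite E; ring.
  apply: le_trans (le_normcD _ _) _; rewrite normcN -nv.
  exact: lerD.
have : normc (h 0) * 4 <= normc (h 0) * normc (square_sum GRing.inv N a v).
  by apply: ler_wpM2l => //; exact: normc_ge0.
lra.
Qed.

Lemma derivable_exprn d z : derivable (fun x : C^o => x ^+ d : C^o) z 1.
Proof.
elim: d => [|d IH].
  rewrite (_ : (fun x => _) = cst (1 : C^o)); first exact: derivable_cst.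
  by apply/funext => x; rewrite expr0.
rewrite (_ : (fun x => _) = (fun x : C^o => x * x ^+ d : C^o)).
  exact: (@derivableM _ _ (id : C^o -> C^o) (fun x : C^o => x ^+ d : C^o)
    z 1 (@derivable_id _ _ _ _) IH).
by apply/funext => x; rewrite exprS.
Qed.

(** Cauchy's estimate around 1 is applied to [k s / s^d]. For [3 <= |u| <= 6] the point [1 + u] has
    modulus at least 2 and less than 10, so [|k 1| <= 2 M / 2^d] for every [d]. *)
Lemma infinite_order_zero (k : C -> C) (M : R) :
  (forall s, normc s < 10 -> derivable (k : C^o -> C^o) s 1) ->
  (forall s, normc s < 10 -> normc (k s) <= M) ->
  (forall d : nat, exists2 H : C -> C, derivable (H : C^o -> C^o) 0 1 &
     \forall s \near (0 : C^o), k s = s ^+ d * H s) ->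
  k 1 = 0.
Proof.
move=> dk kM kH.
have M0 : 0 <= M.
  apply: le_trans (normc_ge0 (k 0)) (kM _ _).
  by rewrite normc0; lra.
have nc1 : normc 1 = 1 by rewrite normc1.
have bound d : normc (k 1) <= 2 * M / 2 ^+ d.
  have [H dH kE] := kH d.
  (* The value [H 0] removes the singularity: near 0, [G] coincides with [H]. *)
  pose G (s : C) := if s == 0 then H 0 else k s / s ^+ d.
  pose h u := G (1 + u).
  have dG s : normc s < 10 -> derivable (G : C^o -> C^o) s 1.
    move=> s10; have [->|s0] := eqVneq s 0.
      apply: near_eq_derivable dH; apply: filterS kE => x E; rewrite /G.
      by case: eqVneq => [->//|x0]; rewrite E mulrAC divff ?mul1r // expf_neq0.
    apply: (@near_eq_derivable _ _ _ (fun s : C^o => (k s / s ^+ d : C^o))).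
      have : \forall x \near (s : C^o), x != 0.
        apply/nbhs_normP; exists `|s|; first by rewrite /= normr_gt0.
        by move=> x /= sx; apply/eqP => x0; move: sx; rewrite x0 subr0 ltxx.
      by apply: filterS => x /negbTE x0; rewrite /G x0.
    apply: (@derivableM _ _ (k : C^o -> C^o) (fun x : C^o => (x ^+ d)^-1 : C^o)).
      exact: dk.
    apply: derivableV; first exact: expf_neq0.
    exact: derivable_exprn.
  have dh u : normc u <= 6 -> derivable (h : C^o -> C^o) u 1.
    move=> u6; apply/derivable1_diffP.
    apply: (@differentiable_comp _ _ _ _ (fun u : C^o => (1 + u : C^o))
      (G : C^o -> C^o)).
      apply: differentiableD => //; exact: differentiable_cst.
    apply/derivable1_diffP; apply: dG.
    by apply: le_lt_trans (le_normcD _ _) _; rewrite nc1; lra.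
  have -> : k 1 = h 0 by rewrite /h /G addr0 oner_eq0 expr1n divr1.
  rewrite -mulrA; apply: cauchy_estimate => // u u36; rewrite /h /G.
  have u2 : 2 <= normc (1 + u).
    have := le_normcD (1 + u) (- 1).
    by rewrite normcN nc1 addrAC subrr add0r; lra.
  have u0 : 1 + u != 0.
    by apply/eqP => u0; move: u2; rewrite u0 normc0; lra.
  rewrite (negbTE u0) normcM normcV.
  have ncX (x : C) n : normc (x ^+ n) = normc x ^+ n.
    elim: n => [|n IH]; first by rewrite !expr0.
    by rewrite !exprS normcM IH.
  apply: ler_pM; rewrite ?normc_ge0 ?invr_ge0 ?normc_ge0 //.
    by apply: kM; apply: le_lt_trans (le_normcD _ _) _; rewrite nc1; lra.
  rewrite lef_pV2 ?posrE ?exprn_gt0 //; last first.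
    by rewrite ncX exprn_gt0 //; lra.
  by rewrite ncX; apply: lerXn2r => //; rewrite nnegrE; lra.
apply: eq0_normc; apply/eqP; rewrite eq_le normc_ge0 andbT.
apply/ler_addgt0Pr => e e0; rewrite add0r.
have [d Hd] := div_exp2_lt (2 * M) e0.
exact: le_trans (bound d) (ltW Hd).
Qed.
End ComplexAnalysis.

(** * Vanishing of holomorphic germs *)

Section Balls.
Variables (K : numFieldType) (V : normedModType K) (x : V).

Lemma near_ball (P : set V) : nbhs x P ->
  exists2 r : K, 0 < r & forall z, `|x - z| < r -> P z.
Proof. by move=> /nbhs_normP[r /= r0 H]; exists r. Qed.

Lemma ball_near (P : set V) (r : K) : 0 < r ->
  (forall z, `|x - z| < r -> P z) -> nbhs x P.
Proof. by move=> r0 H; apply/nbhs_normP; exists r. Qed.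
End Balls.

Section Vanishing.
Local Open Scope complex_scope.
Variables (R : realType) (m : nat).
Local Notation C := (R[i] : numFieldType).
Variables (zeta : 'rV[C]_m) (i0 : 'I_m).
Local Notation normc := (@Normc.normc R).

Lemma differentiable_line (z v : 'rV[C]_m) (s : C^o) :
  differentiable (fun s : C^o => z + s *: v) s.
Proof.
apply: differentiableD; first exact: differentiable_cst.
exact: (@differentiableZl _ _ _ (id : C^o -> C)).
Qed.

Lemma cvg_line (z v : 'rV[C]_m) : (fun s : C^o => z + s *: v) @ (0 : C^o) --> z.
Proof.
rewrite -[X in _ --> X](_ : z + (0 : C) *: v = z); last by rewrite scale0r addr0.
exact: differentiable_continuous (differentiable_line z v 0).
Qed.

(** By continuity, a nonzero value at a point of the hyperplane would persist nearby, but a small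
    move in the direction of the coordinate leaves the hyperplane. *)
Lemma vanishing_off_hyperplane (f : 'rV[C]_m -> C^o) :
  holomorphic_at zeta f ->
  (\forall z \near zeta, (z : 'rV[C]_m) 0 i0 != zeta 0 i0 -> f z = 0) ->
  \forall z \near zeta, f z = 0.
Proof.
move=> /near_join hf /near_join f0.
near=> z.
have df : differentiable f z.
  by apply: (@nbhs_singleton _ z (fun x => differentiable f x)); near: z.
have fz0 : \forall x \near z, (x : 'rV[C]_m) 0 i0 != zeta 0 i0 -> f x = 0 by near: z.
apply: contrapT => /eqP fz.
have cf := differentiable_continuous df.
have fn0 : \forall x \near z, f x != 0.
  suff : nbhs (f z) [set y : C^o | y != 0] by move/cf.
  apply/nbhs_normP; exists `|f z|; first by rewrite /= normr_gt0.
  by move=> y /= fy; apply/eqP => y0; move: fy; rewrite y0 subr0 ltxx.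
have [zi|zi] := eqVneq (z 0 i0) (zeta 0 i0); last first.
  by move: fz; rewrite (nbhs_singleton fz0 zi) eqxx.
have H : \forall s \near (0 : C^o), z 0 i0 + s != zeta 0 i0 -> False.
  pose e : 'rV[C]_m := delta_mx 0 i0.
  have : \forall s \near (0 : C^o), ((z + s *: e) 0 i0 != zeta 0 i0 ->
      f (z + s *: e) = 0) /\ f (z + s *: e) != 0.
    exact: (@cvg_line z e _ (filterI fz0 fn0)).
  apply: filterS => s /= [H /eqP fs] si; apply: fs; apply: H.
  by rewrite !mxE !eqxx mulr1.
have : \forall s \near (0 : C^o)^', False.
  apply: filterS H => s /= Hs s0; apply: Hs; rewrite zi.
  by rewrite -subr_eq0 addrAC subrr add0r.
by move=> /filter_ex[].
Unshelve. all: by end_near. Qed.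

(** A point [z] within [r / 10] of [zeta] is the value at [s = 1] of the line [zeta + s (z - zeta)],
    which for [|s| < 10] stays in the ball of radius [r] where [f] is differentiable and bounded. *)
Lemma infinite_order_germ (f : 'rV[C]_m -> C^o) :
  holomorphic_at zeta f ->
  (forall d : nat, exists2 h : 'rV[C]_m -> C^o, holomorphic_at zeta h &
     \forall z \near zeta, f z = ((z : 'rV[C]_m) 0 i0 - zeta 0 i0) ^+ d * h z) ->
  \forall z \near zeta, f z = 0.
Proof.
move=> hf hdiv; apply: vanishing_off_hyperplane => //.
have cf := differentiable_continuous (nbhs_singleton hf).
have bf : \forall z \near zeta, normc (f z) <= normc (f zeta) + 1.
  have : \forall z \near zeta, `|f zeta - f z| < 1.
    by move/cvgrPdist_lt: cf => /(_ 1 ltr01).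
  apply: filterS => z; rewrite [X in X < _]normc_normE ltcR => fz.
  have -> : f z = f zeta - (f zeta - f z) by ring.
  by apply: le_trans (le_normcD _ _) _; rewrite normcN lerD2l ltW.
have [r r0 Hr] := near_ball (filterI hf bf).
have r10 : 0 < r / 10 by rewrite divr_gt0.
apply: (ball_near r10) => z zr zi.
pose v := z - zeta.
have vr : `|v| < r / 10 by rewrite -normrN opprB.
have -> : z = zeta + 1 *: v by rewrite scale1r addrC subrK.
pose k (s : C) : C := f (zeta + s *: v).
have line s : normc s < 10 -> `|zeta - (zeta + s *: v)| < r.
  move=> s10; rewrite opprD addrA subrr add0r normrN normrZ.
  have s10' : `|s| <= 10.
    by rewrite normc_normE -[10](rmorph_nat (real_complex R)) lecR ltW.
  apply: le_lt_trans (ler_wpM2r (normr_ge0 v) s10') _.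
  by rewrite mulrC -ltr_pdivlMr.
apply: (@infinite_order_zero R k (normc (f zeta) + 1)).
- move=> s /line /Hr[df _]; apply/derivable1_diffP.
  apply: (@differentiable_comp _ _ _ _ (fun s : C^o => zeta + s *: v) f) => //.
- by move=> s /line /Hr[_].
- move=> d; have [h /nbhs_singleton dh E] := hdiv d.
  (* Along the line the centred coordinate is [s * v 0 i0], whose power splits off [s^d]. *)
  exists (fun s => (v 0 i0) ^+ d * h (zeta + s *: v)).
    apply: (@derivableM _ _ (cst (v 0 i0 ^+ d) : C^o -> C^o)
      (fun s : C^o => h (zeta + s *: v) : C^o)).
      exact: derivable_cst.
    apply/derivable1_diffP.
    apply: (@differentiable_comp _ _ _ _ (fun s : C^o => zeta + s *: v) h).
      exact: differentiable_line.
    by rewrite scale0r addr0.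
  have : \forall s \near (0 : C^o), f (zeta + s *: v) =
      ((zeta + s *: v) 0 i0 - zeta 0 i0) ^+ d * h (zeta + s *: v).
    exact: (@cvg_line zeta v _ E).
  apply: filterS => s /= {}E.
  rewrite /k E mulrA -exprMn; congr (_ ^+ _ * _).
  by rewrite !mxE addrAC subrr add0r.
Qed.

End Vanishing.

(** * Vector-valued power series *)

(** The algebra of division by [t - s]: [q] will be the quotient at [t], [b] its constant
    coefficient, [w] its shift by one at [t], and [u] the shift of the series at [t]. *)
Lemma horner_step (K : comNzRingType) (V : lmodType K) (s t : K)
    (a b q u w : V) :
  q = u + s *: w -> q = b + t *: w ->
  a + t *: u = a + s *: b + (t - s) *: q.
Proof.
move=> E1 E2; rewrite scalerBl {1}E1 E2 !scalerDr !scalerA [t * s]mulrC opprD.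
by rewrite [X in _ = _ + X]addrACA subrr addr0 -addrA [s *: b + _]addrC subrK.
Qed.

Section PowerSeries.
Local Open Scope complex_scope.
Variable (R : realType).
Local Notation C := (R[i] : numFieldType).
Variable (E : completeNormedModType C).
Implicit Types (c : nat -> E) (t s : C).

(** [limn] is meaningful only under convergence, here ensured by bounded coefficients and
    [|t| <= 1/2]. *)
Definition power_sum c t : E := limn (series (fun j => t ^+ j *: c j)).

Definition bounded_seq (B : R) c := forall j, `|c j| <= B%:C.

Lemma power_sum_tail (B : R) c t a n : bounded_seq B c -> `|t| <= 2^-1 -> 0 <= B ->
  `|\sum_(a <= k < a + n) t ^+ k *: c k| <= (2 * B / 2 ^+ a)%:C.
Proof.
move=> cB t2 B0.
have -> : (2 * B / 2 ^+ a)%:C = B%:C * (2 * 2^-1 ^+ a) :> C.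
  rewrite rmorphM /= fmorphV rmorphM rmorphXn !rmorph_nat /= exprVn; ring.
(* The exact geometric sum is kept so that the induction on [n] closes. *)
suff : `|\sum_(a <= k < a + n) t ^+ k *: c k|
    <= B%:C * (2 * (2^-1 ^+ a - 2^-1 ^+ (a + n))).
  move=> /le_trans; apply; apply: ler_wpM2l; first by rewrite lecR.
  by rewrite ler_pM2l // lerBlDr lerDl exprn_ge0 // invr_ge0.
elim: n => [|n IH].
  by rewrite addn0 big_geq // normr0 subrr !mulr0.
rewrite addnS big_nat_recr ?leq_addr //=.
apply: le_trans (ler_normD _ _) _.
apply: le_trans (lerD IH (_ : _ <= B%:C * 2^-1 ^+ (a + n))) _.
  rewrite normrZ normrX mulrC; apply: ler_pM => //.
  by apply: lerXn2r; rewrite ?nnegrE ?invr_ge0.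
rewrite le_eqVlt; apply/orP; left; apply/eqP.
by rewrite exprS; field.
Qed.

Lemma power_sum_cvg (B : R) c t : bounded_seq B c -> `|t| <= 2^-1 ->
  series (fun j => t ^+ j *: c j) @ \oo --> power_sum c t.
Proof.
move=> cB t2.
have B0 : 0 <= B by rewrite -lecR; apply: le_trans (cB 0%N).
apply/cauchy_cvgP/cauchy_seriesP => e e0.
have eE : (complex.Re e)%:C = e by apply: RRe_real; exact: gtr0_real.
have e0R : 0 < complex.Re e by rewrite -ltcR eE.
have [N HN] := div_exp2_lt (2 * B) e0R.
exists ([set n | (N <= n)%N], [set n | (N <= n)%N]).
  by split; exists N.
move=> [a b] /= [Na Nb].
have [ab|/ltnW ba] := leqP a b; last by rewrite big_geq // normr0.
rewrite -(subnKC ab); apply: le_lt_trans (power_sum_tail _ _ cB t2 B0) _.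
rewrite -eE ltcR; apply: le_lt_trans HN.
apply: ler_wpM2l; first by rewrite mulr_ge0.
by rewrite lef_pV2 ?posrE ?exprn_gt0 // ler_eXn2l // ltr1n.
Qed.

(** The summand 1 is the distance allowed between the limit and one partial sum. *)
Lemma power_sum_le (B : R) c t : bounded_seq B c -> `|t| <= 2^-1 ->
  `|power_sum c t| <= (2 * B + 1)%:C.
Proof.
move=> cB t2.
have B0 : 0 <= B by rewrite -lecR; apply: le_trans (cB 0%N).
have /cvgrPdist_lt /(_ 1 ltr01) [N _ HN] := power_sum_cvg cB t2.
have := HN N (leqnn N); set u := series _ N => uN.
have -> : power_sum c t = u + (power_sum c t - u) by rewrite addrC subrK.
apply: le_trans (ler_normD _ _) _; rewrite rmorphD rmorph1.
apply: lerD; last exact: ltW.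
have := power_sum_tail 0 N cB t2 B0.
by rewrite add0n expr0 divr1.
Qed.

Lemma power_sumD (B B' : R) c c' t s : bounded_seq B c -> bounded_seq B' c' ->
  `|t| <= 2^-1 ->
  power_sum (fun j => c j + s *: c' j) t = power_sum c t + s *: power_sum c' t.
Proof.
move=> cB cB' t2; apply/cvg_lim => //.
have -> : series (fun j => t ^+ j *: (c j + s *: c' j)) =
  (fun n => series (fun j => t ^+ j *: c j) n
     + s *: series (fun j => t ^+ j *: c' j) n).
  apply/funext => n; rewrite /series /= scaler_sumr -big_split /=.
  by apply: eq_bigr => k _; rewrite scalerDr !scalerA mulrC.
apply: cvgD; first exact: power_sum_cvg cB t2.
by apply: cvgZl_tmp; exact: power_sum_cvg cB' t2.
Qed.

Lemma power_sumS (B : R) c t : bounded_seq B c -> `|t| <= 2^-1 ->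
  power_sum c t = c 0%N + t *: power_sum (fun j => c j.+1) t.
Proof.
move=> cB t2; apply/cvg_lim => //; rewrite -cvg_shiftS.
have -> : [sequence series (fun j => t ^+ j *: c j) n.+1]_n =
  (fun n => c 0%N + t *: series (fun j => t ^+ j *: c j.+1) n).
  apply/funext => n; rewrite /series /= big_nat_recl // expr0 scale1r.
  congr (_ + _); rewrite scaler_sumr.
  by apply: eq_bigr => k _; rewrite scalerA exprS.
apply: cvgD; first exact: cvg_cst.
by apply: cvgZl_tmp; apply: (@power_sum_cvg B) => // j; exact: cB.
Qed.

(* Coefficients of the quotient of a power series by [t - s], as in Horner's
   scheme. *)
Definition horner_quot s c : nat -> E := fun j =>
  power_sum (fun i => c (j + i).+1) s.

Lemma horner_quot_bounded (B : R) s c : bounded_seq B c -> `|s| <= 2^-1 ->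
  bounded_seq (2 * B + 1) (horner_quot s c).
Proof. by move=> cB s2 j; apply: power_sum_le => // i; exact: cB. Qed.

(** The coefficients of the quotient satisfy Horner's recursion [q_j = c_(j+1) + s q_(j+1)];
    comparing it with the splitting off of constant terms gives the identity. *)
Lemma power_sum_quot (B : R) c s t : bounded_seq B c ->
  `|s| <= 2^-1 -> `|t| <= 2^-1 ->
  power_sum c t = power_sum c s + (t - s) *: power_sum (horner_quot s c) t.
Proof.
move=> cB s2 t2; set q := horner_quot s c.
have qB : bounded_seq (2 * B + 1) q := horner_quot_bounded cB s2.
have qB' : bounded_seq (2 * B + 1) (fun j => q j.+1) by move=> j; exact: qB.
have cB' : bounded_seq B (fun j => c j.+1) by move=> j; exact: cB.
have qE : q = fun j => c j.+1 + s *: q j.+1.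
  apply/funext => j; rewrite {1}/q /horner_quot (@power_sumS B) //.
  have -> : q j.+1 = power_sum (fun i => c (j + i.+1).+1) s.
    by rewrite /q /horner_quot; f_equal; apply/funext => i; rewrite addnS.
  by rewrite addn0.
have E1 : power_sum q t =
    power_sum (fun j => c j.+1) t + s *: power_sum (fun j => q j.+1) t.
  by rewrite {1}qE (power_sumD _ cB' qB').
have E2 : power_sum q t = q 0%N + t *: power_sum (fun j => q j.+1) t.
  exact: power_sumS qB t2.
have E3 : power_sum c t = c 0%N + t *: power_sum (fun j => c j.+1) t.
  exact: power_sumS cB t2.
have E4 : power_sum c s = c 0%N + s *: q 0%N by exact: power_sumS cB s2.
rewrite E3 E4; exact: horner_step E1 E2.
Qed.

(* Dividing twice by [t - s] gives the Taylor expansion of order two at [s], with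
   a bounded remainder. *)
Lemma derivable_power_sum (B : R) c s : bounded_seq B c -> `|s| < 2^-1 ->
  derivable (power_sum c : C^o -> E) s 1.
Proof.
move=> cB s2; have s2' := ltW s2.
have qB := horner_quot_bounded cB s2'.
have qqB := horner_quot_bounded qB s2'.
(* Each division turns a bound [B] on coefficients into [2 B + 1], and so does summation: [B']
   bounds the values of the second quotient. *)
set B' := 2 * (2 * (2 * B + 1) + 1) + 1.
have near_s : \forall h \near (0 : C^o), `|h + s| <= 2^-1.
  apply: (@ball_near _ C^o _ _ (2^-1 - `|s|)); first by rewrite subr_gt0.
  move=> h; rewrite sub0r normrN => hs.
  by apply: le_trans (ler_normD _ _) _; rewrite -lerBrDr ltW.
have B'0 : 0 <= B'%:C :> C.
  by apply: le_trans (power_sum_le qqB s2').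
apply/cvg_ex; exists (power_sum (horner_quot s c) s); apply/cvgrPdist_le => e e0.
rewrite near_withinE.
have e1 : 0 < e / (B'%:C + 1).
  by rewrite divr_gt0 // ltr_wpDl.
have small : \forall h \near (0 : C^o), `|h| < e / (B'%:C + 1).
  by apply: (@ball_near _ C^o _ _ _ e1) => h; rewrite sub0r normrN.
apply: filterS2 near_s small => h hs hsmall h0 /=.
rewrite [_%:A]mulr1 (power_sum_quot cB s2' hs) addrAC subrr add0r addrK scalerA.
rewrite mulVf // scale1r (power_sum_quot qB s2' hs) addrK opprD addrA subrr add0r.
rewrite normrN normrZ.
apply: le_trans (ler_pM _ _ (ltW hsmall) (power_sum_le qqB hs)) _ => //.
rewrite -/B' mulrAC ler_pdivrMr ?ltr_wpDl // ler_pM2l //.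
by rewrite lerDl.
Qed.
End PowerSeries.

(** * Germs *)

Section GermOf.
Local Open Scope quotient_scope.
Variables (K : numFieldType) (m : nat) (zeta : 'rV[K]_m).

(** Total, with default value 0, so that germs can be written down before their holomorphy is
    proved. *)
Definition germ_of (V : normedModType K) (f : 'rV[K]_m -> V) : germ zeta V :=
  if pselect (holomorphic_at zeta f) is left h
  then \pi_(germ zeta V) (Holo h) else 0.

Lemma repr_germ_of (V : normedModType K) (f : 'rV[K]_m -> V) :
  holomorphic_at zeta f -> \forall z \near zeta, repr (germ_of f) z = f z.
Proof. by move=> hf; rewrite /germ_of; case: pselect => // h; exact: germ_repr. Qed.

Definition germ_cst (V : normedModType K) (v : V) : germ zeta V :=
  germ_of (fun=> v).

Lemma repr_germ_cst (V : normedModType K) (v : V) :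
  \forall z \near zeta, repr (germ_cst v) z = v.
Proof. exact: repr_germ_of (holomorphic_at_cst _ _). Qed.

Lemma germ_cstZ (V : normedModType K) (k : K) (v : V) :
  germ_cst (k *: v) = germ_cst (k : K^o) *: germ_cst v.
Proof.
apply: germ_eqP; near=> z.
have -> : repr (germ_cst (k *: v)) z = k *: v by near: z; exact: repr_germ_cst.
have -> : repr (germ_cst (k : K^o) *: germ_cst v) z =
    repr (germ_cst (k : K^o)) z *: repr (germ_cst v) z.
  by near: z; exact: repr_germZ.
have -> : repr (germ_cst (k : K^o)) z = k by near: z; exact: repr_germ_cst.
by have -> : repr (germ_cst v) z = v by near: z; exact: repr_germ_cst.
Unshelve. all: by end_near. Qed.

Lemma repr_germ_sum (V : normedModType K) n (g : 'I_n -> germ zeta V) :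
  \forall z \near zeta, repr (\sum_i g i) z = \sum_i repr (g i) z.
Proof.
elim: n g => [|n IH] g.
  by rewrite big_ord0; apply: filterS (germ0E zeta V) => z ->; rewrite big_ord0.
rewrite big_ord_recl.
apply: filterS2 (repr_germD (g ord0) (\sum_(i < n) g (lift ord0 i)))
  (IH (fun i => g (lift ord0 i))).
by move=> z -> ->; rewrite [RHS]big_ord_recl.
Qed.

(** Near [zeta] the relation holds pointwise, and the values of the [u i] at each point are the
    coefficients of a relation in [V]. *)
Lemma germ_cst_free (V : normedModType K) n (e : 'I_n -> V)
    (u : 'I_n -> germ zeta K^o) :
  (forall a : 'I_n -> K, \sum_i a i *: e i = 0 -> forall i, a i = 0) ->
  \sum_i u i *: germ_cst (e i) = 0 -> forall i, u i = 0.
Proof.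
move=> efree E i; apply: germ_eqP; near=> z.
have -> : repr (0 : germ zeta K^o) z = 0 by near: z; exact: germ0E.
apply: (efree (fun i => repr (u i) z)).
transitivity (repr (0 : germ zeta V) z); last by near: z; exact: germ0E.
rewrite -[X in repr X]E.
have -> : repr (\sum_i u i *: germ_cst (e i)) z
    = \sum_i repr (u i *: germ_cst (e i)) z.
  by near: z; exact: repr_germ_sum.
apply: eq_bigr => j _.
have -> : repr (u j *: germ_cst (e j)) z = repr (u j) z *: repr (germ_cst (e j)) z.
  move: j; near: z; apply: filter_forall => j; exact: repr_germZ.
congr (_ *: _); symmetry.
move: j; near: z; apply: filter_forall => j; exact: repr_germ_cst.
Unshelve. all: by end_near. Qed.

Variable i0 : 'I_m.

Definition coordB (z : 'rV[K]_m) : K^o := z 0 i0 - zeta 0 i0.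

Lemma differentiable_coordB z : differentiable coordB z.
Proof.
apply: differentiableB; first exact: differentiable_coord.
exact: differentiable_cst.
Qed.

Definition germ_coord : germ zeta K^o := germ_of coordB.

Lemma repr_germ_coord : \forall z \near zeta, repr germ_coord z = coordB z.
Proof.
apply: repr_germ_of; rewrite /holomorphic_at; near=> z.
exact: differentiable_coordB.
Unshelve. all: by end_near. Qed.

Lemma repr_germ_coordX d :
  \forall z \near zeta, repr (germ_coord ^+ d) z = coordB z ^+ d.
Proof.
elim: d => [|d IH]; first by apply: filterS (germ1E zeta).
rewrite exprS.
apply: filterS3 (repr_germM germ_coord (germ_coord ^+ d)) repr_germ_coord IH.
by move=> z -> -> ->; rewrite exprS.
Qed.
End GermOf.

(** * The coordinate germ and series in its powers *)

Section ComplexGerms.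
Variables (R : realType) (m : nat).
Local Notation C := (R[i] : numFieldType).
Variables (zeta : 'rV[C]_m) (i0 : 'I_m).
Local Notation T := (germ_coord zeta i0).

(** Supplies the exponents of the gliding hump: some power of [T] fails to divide a given nonzero
    scalar germ. *)
Lemma germ_coord_separated (a : germ zeta C^o) :
  (forall d, exists h, a = T ^+ d * h) -> a = 0.
Proof.
move=> aT; apply: germ_eqP.
have H : \forall z \near zeta, repr a z = 0.
  apply: (infinite_order_germ (i0 := i0)); first exact: holo_holomorphic.
  move=> d; have [h aE] := aT d; exists (repr h); first exact: holo_holomorphic.
  have {}aE : repr a = repr (T ^+ d * h) by rewrite -aE.
  apply: filterS2 (repr_germM (T ^+ d) h) (repr_germ_coordX zeta i0 d).
  by move=> z E1 E2; rewrite aE E1 E2.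
by apply: filterS2 H (germ0E zeta C^o) => z -> ->.
Qed.

Lemma germ_coord_regular (a : germ zeta C^o) : T * a = 0 -> a = 0.
Proof.
move=> Ta; apply: germ_eqP.
have H : \forall z \near zeta, repr a z = 0.
  apply: (vanishing_off_hyperplane (i0 := i0)); first exact: holo_holomorphic.
  have Ta' : repr (T * a) = repr (0 : germ zeta C^o) by rewrite Ta.
  apply: filterS3 (repr_germM T a) (repr_germ_coord zeta i0) (germ0E zeta C^o).
  move=> z E1 E2 E3 zi; move: E1; rewrite Ta' E3 E2 => /esym/eqP.
  by rewrite mulf_eq0 /coordB subr_eq0 (negbTE zi) => /eqP.
by apply: filterS2 H (germ0E zeta C^o) => z -> ->.
Qed.

Variable E : completeNormedModType C.

(** The sum of the [T^j c_j]; for bounded [c] it is holomorphic because [|T| < 1/2] near [zeta]. *)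
Definition germ_series (c : nat -> E) : germ zeta E :=
  germ_of zeta (fun z => power_sum c (coordB zeta i0 z)).

Lemma near_coord_small : \forall z \near zeta, `|coordB zeta i0 z| < 2^-1.
Proof.
have := differentiable_continuous (differentiable_coordB zeta i0 zeta).
move=> /cvgrPdist_lt /(_ 2^-1); rewrite invr_gt0 => /(_ (ltr0Sn _ 1)).
by apply: filterS => z; rewrite {1}/coordB subrr sub0r normrN.
Qed.

Lemma repr_germ_series (B : R) c : bounded_seq B c ->
  \forall z \near zeta, repr (germ_series c) z = power_sum c (coordB zeta i0 z).
Proof.
move=> cB; apply: repr_germ_of; apply: filterS near_coord_small => z z2.
apply: (@differentiable_comp _ _ _ _ (coordB zeta i0) (power_sum c : C^o -> E)).
  exact: differentiable_coordB.
by apply/derivable1_diffP; exact: derivable_power_sum cB z2.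
Qed.

Lemma germ_seriesS (B : R) c : bounded_seq B c ->
  germ_series c = germ_cst zeta (c 0%N) + T *: germ_series (fun j => c j.+1).
Proof.
move=> cB; have cB' : bounded_seq B (fun j => c j.+1) by move=> j; exact: cB.
apply: germ_eqP; near=> z.
have -> : repr (germ_series c) z = power_sum c (coordB zeta i0 z).
  by near: z; exact: repr_germ_series cB.
have -> : repr (germ_cst zeta (c 0%N) + T *: germ_series (fun j => c j.+1)) z =
    repr (germ_cst zeta (c 0%N)) z + repr (T *: germ_series (fun j => c j.+1)) z.
  by near: z; exact: repr_germD.
have -> : repr (T *: germ_series (fun j => c j.+1)) z =
    repr T z *: repr (germ_series (fun j => c j.+1)) z.
  by near: z; exact: repr_germZ.
have -> : repr (germ_cst zeta (c 0%N)) z = c 0%N.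
  by near: z; exact: repr_germ_cst.
have -> : repr T z = coordB zeta i0 z by near: z; exact: repr_germ_coord.
have -> : repr (germ_series (fun j => c j.+1)) z
    = power_sum (fun j => c j.+1) (coordB zeta i0 z).
  by near: z; exact: repr_germ_series cB'.
have /ltW z2 : `|coordB zeta i0 z| < 2^-1 by near: z; exact: near_coord_small.
exact: power_sumS cB z2.
Unshelve. all: by end_near. Qed.

Lemma germ_series_split (B : R) c n : bounded_seq B c ->
  germ_series c = \sum_(j < n) T ^+ j *: germ_cst zeta (c j)
    + T ^+ n *: germ_series (fun j => c (n + j)%N).
Proof.
move=> cB; elim: n => [|n IH].
  by rewrite big_ord0 add0r expr0 scale1r.
rewrite IH big_ord_recr /= -addrA; congr (_ + _).
rewrite (@germ_seriesS B); last by move=> j; exact: cB.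
rewrite addn0 scalerDr scalerA -exprSr; congr (_ + _ *: germ_series _).
by apply/funext => j; rewrite addnS.
Qed.
End ComplexGerms.

(** * Linear algebra over rings and bases *)

Lemma tall_matrix_kernel (A : comNzRingType) n (M : 'M[A]_(n.+1, n)) :
  exists2 u : 'rV_n.+1, u != 0 & u *m M = 0.
Proof.
(* Otherwise [M], padded to a square matrix [P] with a zero column, is injective;
   an annihilating monic polynomial of [P] has zero constant term because of the
   zero column, so it can be divided by ['X] by injectivity. *)
apply: contrapT => inj0.
have inj (u : 'rV_n.+1) : u *m M = 0 -> u = 0.
  by move=> uM; apply: contrapT => /eqP u0; apply: inj0; exists u.
pose P : 'M[A]_n.+1 := row_mx (0 : 'M[A]_(n.+1, 1)) M.
have mulP (Q : 'M[A]_n.+1) : Q *m P = row_mx (0 : 'M[A]_(n.+1, 1)) (Q *m M).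
  by have := mul_mx_row Q (0 : 'M[A]_(n.+1, 1)) M; rewrite mulmx0.
have nomonic (p : {poly A}) : p \is monic -> horner_mx P p <> 0.
  elim/poly_ind: p => [|p c IH]; first by rewrite monicE lead_coef0 eq_sym oner_eq0.
  move=> pm; rewrite rmorphD rmorphM /= horner_mx_X horner_mx_C => E.
  set Q := horner_mx P p in E.
  have Q0 : (Q *m P) 0 0 = 0.
    by rewrite mulP mxE; case: splitP => j //= _; rewrite mxE.
  have c0 : c = 0.
    have := congr1 (fun N : 'M[A]_n.+1 => N 0 0) E.
    by rewrite mxE [X in X + _]Q0 add0r !mxE eqxx mulr1n.
  have {}E : Q *m P = 0 by move: E; rewrite c0 raddf0 addr0.
  have QM : Q *m M = 0.
    move: E; rewrite mulP => /(congr1 (@rsubmx _ _ 1 n)).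
    by rewrite row_mxKr linear0.
  apply: IH; last first.
    apply/row_matrixP => i; rewrite row0; apply: inj.
    by rewrite -row_mul QM row0.
  by move: pm; rewrite c0 addr0 monicE lead_coef_Mmonic ?monicX.
exact: nomonic (char_poly_monic P) (Cayley_Hamilton P).
Qed.

(** * Coordinates with respect to a basis *)

Section Coordinates.
Variables (A : nzRingType) (F : lmodType A) (B : set F) (basisB : is_basis B).

Lemma basis_expansion_ex (x : F) : exists sc : {fset F} * (F -> A),
  [set` sc.1] `<=` B /\ x = \sum_(b <- sc.1) sc.2 b *: b.
Proof. by have [s [c ?]] := basisB.1 x; exists (s, c). Qed.

Definition expansion x := projT1 (cid (basis_expansion_ex x)).
Definition supp x : {fset F} := (expansion x).1.
(** Extension by 0 outside the chosen support lets several vectors be expanded over one common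
    finite set. *)
Definition coef b x : A := if b \in supp x then (expansion x).2 b else 0.

Lemma supp_sub x : [set` supp x] `<=` B.
Proof. by rewrite /supp /expansion; case: cid => ? []. Qed.

Lemma coef_out b x : b \notin supp x -> coef b x = 0.
Proof. by rewrite /coef => /negbTE ->. Qed.

Lemma coef_sum (s : {fset F}) x : (supp x `<=` s)%fset ->
  x = \sum_(b <- s) coef b x *: b.
Proof.
move=> xs; rewrite -(big_fset_incl _ xs) /=; last first.
  by move=> b _ /coef_out ->; rewrite scale0r.
have xE : x = \sum_(b <- supp x) (expansion x).2 b *: b.
  by rewrite /supp /expansion; case: cid => ? [].
rewrite [LHS]xE big_seq [RHS]big_seq; apply: eq_bigr => b bx.
by rewrite /coef bx.
Qed.

Lemma coef_eq0 x : (forall b, coef b x = 0) -> x = 0.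
Proof.
move=> x0; rewrite [LHS](coef_sum (fsubset_refl (supp x))) big1 // => b _.
by rewrite x0 scale0r.
Qed.

(** The expansions are chosen arbitrarily; over a common finite set, independence makes them unique
    and hence linear. *)
Lemma coef_linear b (a : A) x y : coef b (a *: x + y) = a * coef b x + coef b y.
Proof.
set z := a *: x + y.
pose s := (supp x `|` supp y `|` supp z)%fset.
have xs : (supp x `<=` s)%fset by rewrite /s -fsetUA fsubsetUl.
have ys : (supp y `<=` s)%fset.
  exact: fsubset_trans (fsubsetUr _ _) (fsubsetUl _ _).
have zs : (supp z `<=` s)%fset by rewrite /s fsubsetUr.
have sB : [set` s] `<=` B.
  move=> u /=; rewrite !inE => /orP[/orP[]|]; exact: supp_sub.
have [bs|bs] := boolP (b \in s); last first.
  have out (S : {fset F}) : (S `<=` s)%fset -> b \notin S.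
    by move=> /fsubsetP H; apply: contra bs => /H.
  by rewrite !coef_out ?out // mulr0 addr0.
apply/eqP; rewrite -subr_eq0; apply/eqP.
apply: (basisB.2 s (fun b => coef b z - (a * coef b x + coef b y)) sB _ b bs).
rewrite (eq_bigr (fun b => coef b z *: b - (a *: (coef b x *: b) + coef b y *: b))).
  rewrite sumrB big_split /= -scaler_sumr.
  by rewrite -(coef_sum zs) -(coef_sum xs) -(coef_sum ys) subrr.
by move=> u _; rewrite scalerBl scalerDl scalerA.
Qed.
End Coordinates.

(** * Independent vectors in infinite dimension *)

Section Independent.
Variables (K : fieldType) (V : lmodType K).

(** A spanning finite independent set would be a finite basis, so some vector lies outside the span
    and can be added. *)
Lemma independent_fset_extend (s : {fset V}) : infinite_dimensional V ->
  linearly_independent [set` s] ->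
  exists2 v, v \notin s & linearly_independent [set` (v |` s)%fset].
Proof.
move=> infV sind.
have [v nv] : exists v : V, ~ exists (s' : {fset V}) (c : V -> K),
    [set` s'] `<=` [set` s] /\ v = \sum_(b <- s') c b *: b.
  by apply/existsNP => sp; apply: infV; exists [set` s].
exists v.
  apply/negP => vs; apply: nv; exists [fset v]%fset, (fun=> 1); split.
    by move=> u /=; rewrite inE => /eqP ->.
  by rewrite big_seq_fset1 scale1r.
move=> s' c s's E.
have s'D : [set` (s' `\ v)%fset] `<=` [set` s].
  move=> u /=; rewrite !inE => /andP[uv us'].
  by have := s's u us'; rewrite /= !inE (negbTE uv).
have cv : v \in s' -> c v = 0.
  move=> vs'; apply: contrapT => /eqP cv; apply: nv.
  exists (s' `\ v)%fset, (fun b => - (c v)^-1 * c b); split => //.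
  move: E; rewrite (big_fsetD1 v) //= => /eqP; rewrite addr_eq0 => /eqP E.
  under eq_bigr do rewrite -scalerA.
  rewrite -scaler_sumr -[\sum_(_ <- _) _]opprK -E scalerN scaleNr opprK scalerA.
  by rewrite mulVf // scale1r.
have E' : \sum_(b <- (s' `\ v)%fset) c b *: b = 0.
  have [vs'|vs'] := boolP (v \in s').
    by move: E; rewrite (big_fsetD1 v) //= cv // scale0r add0r.
  by rewrite mem_fsetD1.
move=> b bs'; have [bv|bv] := eqVneq b v.
  by rewrite bv; apply: cv; rewrite -bv.
by apply: (sind _ _ s'D E' b); rewrite !inE bv.
Qed.

Lemma independent_family n : infinite_dimensional V ->
  exists e : 'I_n -> V, forall a : 'I_n -> K,
    \sum_i a i *: e i = 0 -> forall i, a i = 0.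
Proof.
move=> infV.
have [s [sn sind]] : exists s : {fset V},
    #|` s|%fset = n /\ linearly_independent [set` s].
  elim: n => [|n [s [sn sind]]].
    exists fset0; split; first by rewrite cardfs0.
    by move=> s c s0 _ b bs; have := s0 b bs; rewrite /= inE.
  have [v vs vind] := independent_fset_extend infV sind.
  by exists (v |` s)%fset; split => //; rewrite cardfsU1 vs sn.
exists (fun i => nth 0 s i) => a E i.
pose c (b : V) := if insub (index b s) is Some i then a i else 0.
have cE (j : 'I_n) : c (nth 0 s j) = a j.
  by rewrite /c index_uniq ?sn // ?fset_uniq // valK.
have js (j : 'I_n) : nth 0 s j \in s by rewrite mem_nth // sn.
rewrite -cE; apply: (sind s c) => //.
rewrite -[RHS]E (big_nth 0) sn big_mkord.
by apply: eq_bigr => j _; rewrite cE.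
Qed.
End Independent.

(** * The gliding hump *)

Section GlidingHump.
Variables (R : realType) (m : nat).
Local Notation C := (R[i] : numFieldType).
Variables (zeta : 'rV[C]_m) (i0 : 'I_m) (E : completeNormedModType C).
Local Notation O := (germ zeta C^o).
Local Notation T := (germ_coord zeta i0).
Variables (F : lmodType O) (B : set F) (basisB : is_basis B).
Variable (f : {linear germ zeta E -> F}).

Let image_coef b (x : germ zeta E) : O := coef basisB b (f x).

Lemma image_coef_linear b (a : O) x y :
  image_coef b (a *: x + y) = a * image_coef b x + image_coef b y.
Proof. by rewrite /image_coef linearP coef_linear. Qed.

Lemma image_coef0 b : image_coef b 0 = 0.
Proof.
by have := image_coef_linear b (-1) 0 0; rewrite scaler0 add0r mulN1r addNr.
Qed.

Lemma image_coefD b x y : image_coef b (x + y) = image_coef b x + image_coef b y.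
Proof. by rewrite -[x]scale1r image_coef_linear mul1r scale1r. Qed.

Lemma image_coefZ b a x : image_coef b (a *: x) = a * image_coef b x.
Proof. by rewrite -[a *: x]addr0 image_coef_linear image_coef0 addr0. Qed.

Lemma image_coef_sum b n (g : 'I_n -> germ zeta E) :
  image_coef b (\sum_i g i) = \sum_i image_coef b (g i).
Proof.
elim: n g => [|n IH] g; first by rewrite !big_ord0 image_coef0.
by rewrite !big_ord_recl image_coefD IH.
Qed.

Lemma germ_cst0 : germ_cst zeta (0 : E) = 0.
Proof.
apply: germ_eqP.
by apply: filterS2 (repr_germ_cst zeta (0 : E)) (germ0E zeta E) => z -> ->.
Qed.

Lemma germ_coordX_regular n (a : O) : T ^+ n * a = 0 -> a = 0.
Proof.
elim: n => [|n IH]; first by rewrite expr0 mul1r.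
by rewrite exprS -mulrA => /germ_coord_regular.
Qed.

Lemma finite_support_cst :
  exists S : {fset F}, forall (e : E) b, b \notin S ->
    image_coef b (germ_cst zeta e) = 0.
Proof.
apply: contrapT => nS.
(* A nonzero coordinate outside [S] of the image of a constant is not divisible by some power of
   [T]; scaling bounds the constant by 1. *)
have hump (S : {fset F}) : exists p : E * F * nat,
    [/\ `|p.1.1| <= 1, p.1.2 \notin S &
    ~ exists h, image_coef p.1.2 (germ_cst zeta p.1.1) = T ^+ p.2 * h].
  apply: contrapT => npick; apply: nS; exists S => e b bS.
  have [->|e0] := eqVneq e 0; first by rewrite germ_cst0 image_coef0.
  have ne : `|e| != 0 by rewrite normr_eq0.
  have -> : germ_cst zeta e
      = germ_cst zeta (`|e| : C^o) *: germ_cst zeta (`|e|^-1 *: e).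
    by rewrite -germ_cstZ scalerA divff // scale1r.
  rewrite image_coefZ (_ : image_coef b _ = 0) ?mulr0 //.
  apply: (germ_coord_separated (i0 := i0)) => d; apply: contrapT => nd.
  apply: npick; exists (`|e|^-1 *: e, b, d); split => //=.
  by rewrite normrZ normfV normr_id mulVf.
have [p Hp] := choice hump.
(* The set collects the basis elements chosen so far and the supports of the images of the chosen
   constants, so the next basis element is new and does not see the earlier constants. The successor
   of [d] makes the exponents strictly increasing. *)
pose st := fix st k : {fset F} * nat := if k is k'.+1 then
  let: (Q, n) := st k' in
  ((Q `|` supp basisB (f (germ_cst zeta (p Q).1.1)) `|` [fset (p Q).1.2])%fset,
   (n + (p Q).2.+1)%N) else (fset0, 0%N).
pose S_ k := (st k).1; pose n_ k := (st k).2.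
pose e_ k := (p (S_ k)).1.1; pose b_ k := (p (S_ k)).1.2; pose d_ k := (p (S_ k)).2.
have SS k : S_ k.+1 =
    (S_ k `|` supp basisB (f (germ_cst zeta (e_ k))) `|` [fset b_ k])%fset.
  by rewrite /e_ /b_ /S_ /=; case: (st k).
have nS_ k : n_ k.+1 = (n_ k + (d_ k).+1)%N.
  by rewrite /d_ /S_ /n_ /=; case: (st k).
have Smono k l : (k <= l)%N -> (S_ k `<=` S_ l)%fset.
  move=> kl; rewrite -(subnKC kl); elim: (l - k)%N => [|j IH].
    by rewrite addn0 fsubset_refl.
  by rewrite addnS SS -fsetUA; apply: fsubset_trans IH (fsubsetUl _ _).
have nlt k l : (k < l)%N -> (n_ k < n_ l)%N.
  apply: (homo_ltn ltn_trans) => {}k.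
  by rewrite nS_ addnS ltnS leq_addr.
have ninj k l : n_ k = n_ l -> k = l.
  move=> E1; apply/eqP; case: (ltngtP k l) => // /nlt; rewrite E1 ltnn //.
have nk k : (k <= n_ k)%N.
  elim: k => // k IH; apply: leq_ltn_trans IH _; exact: nlt.
have binj : injective b_.
  move=> k l E1; apply/eqP; case: (ltngtP k l) => // H.
    have [_ + _] := Hp (S_ l); rewrite -/(b_ l) -E1.
    by move/fsubsetP: (Smono _ _ H) => /(_ (b_ k)); rewrite SS !inE eqxx orbT => ->.
  have [_ + _] := Hp (S_ k); rewrite -/(b_ k) E1.
  by move/fsubsetP: (Smono _ _ H) => /(_ (b_ l)); rewrite SS !inE eqxx orbT => ->.
(* Lacunary coefficients: [e_ k] at index [n_ k] and 0 elsewhere. Searching up to [j] suffices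
   because [k <= n_ k]. *)
pose c j : E := if [pick k : 'I_j.+1 | n_ k == j] is Some k then e_ k else 0.
have cn k : c (n_ k) = e_ k.
  rewrite /c; case: pickP => [l /eqP/ninj -> //|].
  move=> /(_ (Ordinal (nk k : (k < (n_ k).+1)%N))) /=; by rewrite eqxx.
have cP j : (exists2 k, n_ k = j & c j = e_ k) \/ (c j = 0 /\ forall k, n_ k <> j).
  rewrite /c; case: pickP => [l /eqP nl|none]; first by left; exists (val l).
  right; split=> // k kj; have kj' : (k < j.+1)%N by rewrite ltnS -kj.
  by have := none (Ordinal kj'); rewrite /= kj eqxx.
have cB : bounded_seq 1 c.
  move=> j; rewrite rmorph1; have [[k _ ->]|[-> _]] := cP j; last by rewrite normr0.
  by have [] := Hp (S_ k).
pose x := germ_series zeta i0 c.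
(* The [b_ k] are distinct, so they cannot all lie in the finite support of [f x]. *)
have [k kx] : exists k, b_ k \notin supp basisB (f x).
  apply: contrapT => /forallNP nk'.
  have sub : {subset [seq b_ k | k <- iota 0 (#|` supp basisB (f x)|%fset).+1]
      <= supp basisB (f x)}.
    by move=> _ /mapP[k _ ->]; apply: contrapT => /negP; exact: nk'.
  have := uniq_leq_size _ sub.
  rewrite map_inj_uniq // iota_uniq size_map size_iota => /(_ isT).
  by rewrite ltnn.
have b0 : image_coef (b_ k) x = 0 by rewrite /image_coef coef_out.
have := germ_series_split zeta i0 (n_ k.+1) cB.
rewrite -/x => xE; move: b0; rewrite xE image_coefD image_coefZ image_coef_sum.
set y := image_coef _ (germ_series _ _ _).
have kk : (n_ k < n_ k.+1)%N by exact: nlt.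
(* Only index [n_ k] contributes: any other term is zero or comes from some [e_ l] with [l < k],
   whose image is supported in [S_ k], and [b_ k] avoids that set. *)
rewrite (bigD1 (Ordinal kk)) //= big1 ?addr0; last first.
  move=> j jk; rewrite image_coefZ; have [[l nl ->]|[-> _]] := cP j; last first.
    by rewrite germ_cst0 image_coef0 mulr0.
  have lk : (l < k)%N.
    case: (ltngtP l k) => // [kl|lk].
      move: (ltn_ord j); rewrite -nl; have := kl; rewrite leq_eqVlt => /orP[/eqP->|].
        by rewrite ltnn.
      by move=> /nlt /ltn_trans H /H; rewrite ltnn.
    by move/eqP: jk; case; apply/val_inj; rewrite /= -nl lk.
  rewrite [image_coef _ _]coef_out ?mulr0 //.
  have [_ + _] := Hp (S_ k); apply: contra => bs.
  by move/fsubsetP: (Smono _ _ lk); apply; rewrite SS !inE bs !orbT.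
(* Cancelling [T^(n_ k)] leaves the [b_ k]-coordinate of the image of [e_ k] equal to
   [- T^(d_k + 1) y], against the choice of [d_ k]. *)
rewrite image_coefZ cn nS_ exprD -mulrA -mulrDr => /germ_coordX_regular /eqP.
rewrite addr_eq0 => /eqP E1.
have [_ _] := Hp (S_ k); apply; exists (- (T * y)).
by rewrite -/(b_ k) -/(e_ k) -/(d_ k) E1 exprSr -mulrA mulrN.
Qed.

Lemma no_injection : infinite_dimensional E -> ~ injective f.
Proof.
move=> infE finj.
have [S HS] := finite_support_cst.
have [e efree] := independent_family #|` S|%fset.+1 infE.
(* One more row than columns: the coordinates in [S] determine the images of constants. *)
pose M : 'M[O]_(#|` S|%fset.+1, #|` S|%fset) :=
  \matrix_(i, j) image_coef (nth 0 S j) (germ_cst zeta (e i)).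
have [u u0 uM] := tall_matrix_kernel M.
pose x := \sum_i u 0 i *: germ_cst zeta (e i).
have coefx b : image_coef b x = \sum_i u 0 i * image_coef b (germ_cst zeta (e i)).
  by rewrite image_coef_sum; apply: eq_bigr => i _; rewrite image_coefZ.
have fx : f x = 0.
  apply: (coef_eq0 (basisB := basisB)) => b; rewrite -/(image_coef b x) coefx.
  have [bS|bS] := boolP (b \in S); last first.
    by rewrite big1 // => i _; rewrite HS // mulr0.
  have bi : (index b S < #|` S|%fset)%N by rewrite index_mem.
  transitivity ((u *m M) 0 (Ordinal bi)); last by rewrite uM mxE.
  rewrite mxE; apply: eq_bigr => i _.
  by rewrite !mxE /= nth_index.
have x0 : x = 0 by apply: finj; rewrite fx linear0.
move/eqP: u0; apply; apply/rowP => i; rewrite mxE.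
exact: (germ_cst_free (u := fun i => u 0 i) efree x0).
Qed.
End GlidingHump.

Theorem corollary1p4 (R : realType) (m : nat) (hm : (0 < m)%N)
    (zeta : 'rV[R[i]]_m) (E : completeNormedModType R[i])
    (hE : infinite_dimensional E) :
  ~ free_module (germ zeta E) /\
  forall F : lmodType (germ zeta R[i]^o), free_module F ->
    ~ exists f : {linear germ zeta E -> F}, injective f.
Proof.
have noinj (F : lmodType (germ zeta R[i]^o)) : free_module F ->
    ~ exists f : {linear germ zeta E -> F}, injective f.
  move=> [B basisB] [f finj].
  exact: (no_injection (Ordinal hm) basisB hE finj).
(* A free module embeds in a free module, namely itself. *)
split=> // free; apply: (noinj _ free).
by exists (idfun : {linear germ zeta E -> germ zeta E}).
Qed.
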